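(* Let $U$ be a Pisot numeration system and $n\ge1$. If a set $P\subseteq\mathbb{N}^n$ is $U$-recognizable, then it is decidable whether $P$ is a $1$-invariant set.
   Context: $\mathbb{N}=\{0,1,2,\ldots\}$. A Pisot numeration system is an increasing integer sequence $U=(U_i)_{i\ge0}$ with $U_0=1$ satisfying a linear recurrence whose characteristic polynomial is the minimal polynomial of a Pisot number (a real algebraic integer $>1$ whose other conjugates have modulus $<1$). Each $m\in\mathbb{N}$ has a greedy $U$-expansion $\mathrm{rep}_U(m)=c_\ell\cdots c_0$ (with $m=\sum c_jU_j$, $\sum_{j\le r}c_jU_j<U_{r+1}$ for all $r$, $c_\ell\ne0$). For $(x_1,\ldots,x_n)$, $\mathrm{rep}_U(x_1,\ldots,x_n)$ is the $n$-tuple of words obtained by left-padding each $\mathrm{rep}_U(x_j)$ with zeros to the common length $\max_j|\mathrm{rep}_U(x_j)|$, read as a word over $n$-tuples of digits. $X\subseteq\mathbb{N}^n$ is $U$-recognizable if $\{\mathrm{rep}_U(\mathbf{x}):\mathbf{x}\in X\}$ is accepted by a deterministic finite automaton (reading most significant digit first). Games: positions are elements of $\mathbb{N}^n$; moves are non-zero $\mathbf{m}\in\mathbb{N}^n$ applicable at $\mathbf{p}$ when $\mathbf{m}\le\mathbf{p}$ componentwise, leading to $\mathbf{p}-\mathbf{m}$. A game is a map $G:\mathbb{N}^n\to2^{\mathbb{N}^n}$ of allowed moves; it is $1$-invariant if $G(\mathbf{p})=I\cap\{\mathbf{m}:\mathbf{m}\le\mathbf{p}\}$ for a fixed $I\subseteq\mathbb{N}^n$.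 Under normal play, $\mathcal{P}(G)$ is the set of positions from which the player to move loses with best play. A set $X$ is $1$-invariant if $X=\mathcal{P}(G)$ for some $1$-invariant game $G$. *)

(* Defs.v *)
From mathcomp Require Import all_boot all_order all_algebra all_field.
From mathcomp Require Import boolp classical_sets.

Set Implicit Arguments.
Unset Strict Implicit.
Unset Printing Implicit Defensive.

Local Open Scope nat_scope.
Local Open Scope classical_set_scope.

(** * Pisot numeration systems *)

(* The conjugates of x are the complex roots of its minimal polynomial over the
   rationals, [minCpoly x]; all of them lie in [algC]. *)
Definition pisot_number (x : algC) : Prop :=
  [/\ x \in Aint, x \is Num.real, (1 < x)%R &
      forall y : algC, root (minCpoly x) y -> y != x -> (`|y| < 1)%R].

(* Over the monic polynomial X^d - a_(d-1) X^(d-1) - ... - a_0, the last clause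
   is U_(i+d) = a_(d-1) U_(i+d-1) + ... + a_0 U_i for every i >= 0. *)
Definition pisot_system (U : nat -> nat) : Prop :=
  [/\ U 0 = 1,
      forall i, U i < U i.+1 &
      exists2 x : algC, pisot_number x &
        forall i : nat,
          (\sum_(j < size (minCpoly x)) (minCpoly x)`_j * (U (i + j))%:R = 0)%R].

(** * Greedy expansions *)

(* The j-th digit c_j of a word c_l ... c_0 written most significant digit
   first. *)
Definition digit (w : seq nat) (j : nat) : nat := nth 0 (rev w) j.

(* The expansion of 0 is the empty word. *)
Definition greedy_expansion (U : nat -> nat) (m : nat) (w : seq nat) : Prop :=
  [/\ m = \sum_(j < size w) digit w j * U j,
      forall r, r < size w -> \sum_(j < r.+1) digit w j * U j < U r.+1 &
      head 1 w != 0].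

Definition position (n : nat) := n.-tuple nat.

Definition rep (U : nat -> nat) (n : nat) (x : position n)
    (w : seq (n.-tuple nat)) : Prop :=
  exists e : 'I_n -> seq nat,
    let L := \max_(j < n) size (e j) in
    [/\ forall j, greedy_expansion U (tnth x j) (e j),
        size w = L &
        forall j, [seq tnth a j | a <- w] = nseq (L - size (e j)) 0 ++ e j].

(** * Automata and recognizable sets *)

(* The alphabet is {0, ..., digits - 1}^n and the set of states is
   {0, ..., states - 1}. *)
Record dfa (n : nat) := DFA {
  digits : nat;
  states : nat;
  start : 'I_states;
  final : pred 'I_states;
  delta : 'I_states -> n.-tuple 'I_digits -> 'I_states
}.

Definition accepts (n : nat) (A : dfa n) (w : seq (n.-tuple 'I_(digits A))) : bool :=
  final (foldl (@delta n A) (start A) w).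

Definition letter_val (n b : nat) (a : n.-tuple 'I_b) : n.-tuple nat :=
  [tuple nat_of_ord (tnth a j) | j < n].

Definition recognizes (U : nat -> nat) (n : nat) (A : dfa n)
    (X : set (position n)) : Prop :=
  [set v | exists2 x, X x & rep U x v] =
  [set [seq letter_val a | a <- w] | w in [set w | accepts (A := A) w]].

(** * Games *)

Definition pos0 (n : nat) : position n := [tuple 0 | j < n].

Definition le_pos (n : nat) (m p : position n) : Prop :=
  forall j, tnth m j <= tnth p j.

Definition sub_pos (n : nat) (p m : position n) : position n :=
  [tuple tnth p j - tnth m j | j < n].

Record game (n : nat) := Game {
  moves :> position n -> set (position n);
  moves_valid : forall p m, moves p m -> m <> pos0 n /\ le_pos m p
}.

(* Normal play: a player who has no move loses. Every play is finite, so each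
   position is either losing or winning for the player to move. *)
Inductive losing (n : nat) (G : game n) (p : position n) : Prop :=
| Losing : (forall m, G p m -> winning G (sub_pos p m)) -> losing G p
with winning (n : nat) (G : game n) (p : position n) : Prop :=
| Winning m : G p m -> losing G (sub_pos p m) -> winning G p.

Definition P_positions (n : nat) (G : game n) : set (position n) :=
  [set p | losing G p].

Definition one_invariant_game (n : nat) (G : game n) : Prop :=
  exists I : set (position n), forall p, G p = I `&` [set m | le_pos m p].

Definition one_invariant (n : nat) (X : set (position n)) : Prop :=
  exists2 G : game n, one_invariant_game G & X = P_positions G.

(** * Partial recursive functions *)

(* Arguments are passed as a list of natural numbers; [Succ] and [Proj] read a
   missing argument as 0. [Rec] recurses on, and [Mu] searches for, the first
   argument. *)
Inductive recfun : Type :=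
| Zero
| Succ
| Proj of nat
| Comp of recfun & seq recfun
| Rec of recfun & recfun
| Mu of recfun.

Inductive eval : recfun -> seq nat -> nat -> Prop :=
| EvalZero xs : eval Zero xs 0
| EvalSucc xs : eval Succ xs (nth 0 xs 0).+1
| EvalProj i xs : eval (Proj i) xs (nth 0 xs i)
| EvalComp f gs xs ys z :
    eval_seq gs xs ys -> eval f ys z -> eval (Comp f gs) xs z
| EvalRec0 f g xs z :
    eval f xs z -> eval (Rec f g) (0 :: xs) z
| EvalRecS f g k xs y z :
    eval (Rec f g) (k :: xs) y -> eval g [:: k, y & xs] z ->
    eval (Rec f g) (k.+1 :: xs) z
| EvalMu f xs y :
    (forall k, k < y -> exists v, eval f (k :: xs) v.+1) ->
    eval f (y :: xs) 0 -> eval (Mu f) xs y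
with eval_seq : seq recfun -> seq nat -> seq nat -> Prop :=
| EvalNil xs : eval_seq [::] xs [::]
| EvalCons g gs xs y ys :
    eval g xs y -> eval_seq gs xs ys -> eval_seq (g :: gs) xs (y :: ys).

(* All letters in lexicographic order. The library's [enum] on tuples is sealed,
   so that its order is unspecified and cannot serve in an effective encoding. *)
Fixpoint letters (n b : nat) : seq (n.-tuple 'I_b) :=
  if n is n'.+1
  then [seq cons_tuple x t | x <- enum 'I_b, t <- letters n' b]
  else [:: [tuple]].

(* An automaton is presented to an algorithm by its table: the number of digits,
   the number of states, the initial state, the acceptance flags of the states,
   and the transitions, row by row. Lists are turned into numbers by the
   bijection [CodeSeq.code]. *)
Definition dfa_code (n : nat) (A : dfa n) : seq nat :=
  [:: digits A; states A; nat_of_ord (start A);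
      CodeSeq.code [seq nat_of_bool (final q) | q <- enum 'I_(states A)];
      CodeSeq.code [seq nat_of_ord (delta q a)
                     | q <- enum 'I_(states A), a <- letters n (digits A)]].

(* Main.v *)
(** Taking as moves all differences that P avoids, P is 1-invariant iff for
    every q outside P there is p <= q in P such that no r, t in P satisfy
    t + p = r + q. Since P is the set of values of the words accepted by the
    automaton, this is a statement about words whose only arithmetic ingredient
    is the set of integer words (with bounded digits) of value zero. For a Pisot
    system U_m = c th^m + e_m with (e_m) summable, so a prefix of a word of value
    zero leads to one of finitely many vectors of partial values, and that set
    is regular. The subset construction then gives an automaton for the
    counterexamples q, with an explicit bound on its number of states; pumping
    bounds all quantifiers by a computable function of the number of states of
    the given automaton, and a bounded search is recursive. *)

(* Only the bounds have to be computable, not the automata: these occur in correctness proofs alone,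
   so they are built classically and [recog] records just a number of states. [U] and [n] are fixed
   before the recursive function is chosen, so the constants [c] (bound on greedy digits) and [K]
   (states testing equality of values) may come from bare existence statements and be hard-wired.
   For [K] to be independent of the given automaton, whose alphabet may be arbitrarily large, its
   accepted words are transferred to the alphabet {0,...,c}^n. Cutting every quantifier down to
   short words is delicate, as membership in P occurs both positively and negatively. The
   counterexample q is shortened by pumping. Then p <= q needs no pumping: an accepted word has a
   non-zero leading digit in some component, so it is no longer than the value of that component.
   Finally r and t are shortened only beyond the letters of q and p, which leaves both values
   unchanged. *)
Require Import Defs.
From mathcomp Require Import all_boot all_order all_algebra all_field.
From mathcomp Require Import boolp classical_sets.
From mathcomp Require Import zify ring.

Set Implicit Arguments.
Unset Strict Implicit.
Unset Printing Implicit Defensive.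

Local Open Scope nat_scope.

(** * Recursive functions *)

(* F reads its m arguments through the environment [nth 0 xs], so that entering
   a binder only shifts the indices. *)
Definition computable (m : nat) (F : (nat -> nat) -> nat) : Prop :=
  exists r, forall xs, size xs = m -> eval r xs (F (nth 0 xs)).

Lemma computable_ext m F G :
  (forall e, F e = G e) -> computable m F -> computable m G.
Proof. by move=> FG [r hr]; exists r => xs /hr; rewrite FG. Qed.

Lemma computable_var m i : computable m (fun e => e i).
Proof. by exists (Proj i) => xs _; apply: EvalProj. Qed.

Lemma computable_succ m F : computable m F -> computable m (fun e => (F e).+1).
Proof.
move=> [r hr]; exists (Comp Succ [:: r]) => xs sx.
apply: (@EvalComp _ _ _ [:: F (nth 0 xs)]); last exact: EvalSucc.
by apply: EvalCons; [exact: hr | exact: EvalNil].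
Qed.

Lemma computable_cst m c : computable m (fun _ => c).
Proof.
elim: c => [|c IH]; last exact: computable_succ.
by exists Zero => xs _; apply: EvalZero.
Qed.

Lemma eval_seq_exists m (gs : seq ((nat -> nat) -> nat)) :
  foldr (fun g P => computable m g /\ P) True gs ->
  exists rs, forall xs, size xs = m ->
    eval_seq rs xs [seq g (nth 0 xs) | g <- gs].
Proof.
elim: gs => [_|g gs IH /= [[r hr] /IH[rs hrs]]].
  by exists [::] => xs _; apply: EvalNil.
exists (r :: rs) => xs sx.
by apply: EvalCons; [exact: hr | exact: hrs].
Qed.

Lemma computable_comp k m F (gs : seq ((nat -> nat) -> nat)) :
  size gs = k -> computable k F ->
  foldr (fun g P => computable m g /\ P) True gs ->
  computable m (fun e => F (nth 0 [seq g e | g <- gs])).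
Proof.
move=> sg [r hr] /eval_seq_exists[rs hrs]; exists (Comp r rs) => xs sx.
apply: EvalComp; first exact: hrs.
by apply: hr; rewrite size_map.
Qed.

Lemma foldr_computable_var m (js : seq nat) :
  foldr (fun g P => computable m g /\ P) True [seq (fun e => e i) | i <- js].
Proof. by elim: js => //= j js IH; split=> //; apply: computable_var. Qed.

Lemma map_var_id m xs (gs := [seq (fun e : nat -> nat => e i) | i <- iota 0 m]) :
  size xs = m -> [seq g (nth 0 xs) | g <- gs] = xs.
Proof.
move=> sx; rewrite -map_comp; apply: (@eq_from_nth _ 0).
  by rewrite size_map size_iota.
move=> i; rewrite size_map size_iota => im.
by rewrite (nth_map 0) ?size_iota // nth_iota //= add0n.
Qed.

Definition nrec (a : nat) (s : nat -> nat -> nat) (k : nat) : nat :=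
  nat_rect (fun=> nat) a s k.

(** In the body, variable 0 is the counter and variable 1 the value so far, as in [Rec]; the ambient
    environment is shifted by two. *)
Lemma computable_nrec m a k (s : nat -> nat -> (nat -> nat) -> nat) :
  computable m a -> computable m k ->
  computable m.+2 (fun e => s (e 0) (e 1) (fun i => e i.+2)) ->
  computable m (fun e =>
    nrec (a e) (fun i y => s i y e) (k e)).
Proof.
move=> [ra ha] [rk hk] [rs hs].
have [ps hps] := eval_seq_exists (foldr_computable_var m (iota 0 m)).
exists (Comp (Rec ra rs) (rk :: ps)) => xs sx.
apply: (@EvalComp _ _ _ (k (nth 0 xs) :: xs)).
  apply: EvalCons; first exact: hk.
  by have := hps _ sx; rewrite map_var_id.
elim: (k _) => [|i IH] /=; first by apply: EvalRec0; exact: ha.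
apply: EvalRecS; first exact: IH.
have := hs [:: i, nrec (a (nth 0 xs)) (fun i0 y => s i0 y (nth 0 xs)) i & xs].
by move=> /=; rewrite sx; apply.
Qed.

(** Substitution: with its analogues for more arguments, it lets each function be treated on bare
    variables. *)
Lemma computable_fun1 m (F : nat -> nat) f :
  computable 1 (fun e => F (e 0)) -> computable m f ->
  computable m (fun e => F (f e)).
Proof. by move=> hF h; apply: (computable_comp (gs := [:: f]) _ hF). Qed.

Lemma computable_fun2 m (F : nat -> nat -> nat) f g :
  computable 2 (fun e => F (e 0) (e 1)) -> computable m f -> computable m g ->
  computable m (fun e => F (f e) (g e)).
Proof. by move=> hF h1 h2; apply: (computable_comp (gs := [:: f; g]) _ hF). Qed.

Lemma computable_fun4 m (F : nat -> nat -> nat -> nat -> nat) f g h k :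
  computable 4 (fun e => F (e 0) (e 1) (e 2) (e 3)) ->
  computable m f -> computable m g -> computable m h -> computable m k ->
  computable m (fun e => F (f e) (g e) (h e) (k e)).
Proof.
by move=> hF h1 h2 h3 h4; apply: (computable_comp (gs := [:: f; g; h; k]) _ hF).
Qed.

Lemma computable_fun5 m (F : nat -> nat -> nat -> nat -> nat -> nat) f g h k l :
  computable 5 (fun e => F (e 0) (e 1) (e 2) (e 3) (e 4)) ->
  computable m f -> computable m g -> computable m h -> computable m k ->
  computable m l ->
  computable m (fun e => F (f e) (g e) (h e) (k e) (l e)).
Proof.
by move=> hF h1 h2 h3 h4 h5; apply: (computable_comp (gs := [:: f; g; h; k; l]) _ hF).
Qed.

Lemma computable_pred m f : computable m f -> computable m (fun e => (f e).-1).
Proof.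
apply: (computable_fun1 (F := predn)).
apply: (@computable_ext _ (fun e => nrec 0 (fun i _ => i) (e 0))).
  by move=> e; case: (e 0).
apply: (@computable_nrec 1 (fun=> 0) (fun e => e 0) (fun i _ _ => i));
  [exact: computable_cst | exact: computable_var..].
Qed.

Lemma computable_add m f g :
  computable m f -> computable m g -> computable m (fun e => f e + g e).
Proof.
apply: (computable_fun2 (F := addn)).
apply: (@computable_ext _ (fun e => nrec (e 0) (fun _ y => y.+1) (e 1))).
  by move=> e; elim: (e 1) => [|k /= ->]; rewrite ?addn0 ?addnS.
apply: (@computable_nrec 2 _ _ (fun _ y _ => y.+1)); try exact: computable_var.
by apply: computable_succ; apply: computable_var.
Qed.

Lemma computable_sub m f g :
  computable m f -> computable m g -> computable m (fun e => f e - g e).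
Proof.
apply: (computable_fun2 (F := subn)).
apply: (@computable_ext _ (fun e => nrec (e 0) (fun _ y => y.-1) (e 1))).
  by move=> e; elim: (e 1) => [|k /= ->]; rewrite ?subn0 ?subnS.
apply: (@computable_nrec 2 _ _ (fun _ y _ => y.-1)); try exact: computable_var.
by apply: computable_pred; apply: computable_var.
Qed.

Definition nsum k F : nat := \sum_(i < k) F (nat_of_ord i).

Lemma computable_nsum m k (F : nat -> (nat -> nat) -> nat) :
  computable m k -> computable m.+1 (fun e => F (e 0) (fun i => e i.+1)) ->
  computable m (fun e => nsum (k e) (fun i => F i e)).
Proof.
move=> hk hF.
apply: (@computable_ext _ (fun e => nrec 0
  (fun i y => y + F i e) (k e))).
  by move=> e; rewrite /nsum; elim: (k e) => [|i IH] /=;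
    rewrite ?big_ord0 ?big_ord_recr /= ?IH.
apply: (@computable_nrec m _ _ (fun i y e => y + F i e)) => //; first exact: computable_cst.
apply: computable_add; first exact: computable_var.
(* The recursion puts the accumulator in variable 1, which the summand does not expect; composing
   with these projections removes it. *)
pose gs := (fun e : nat -> nat => e 0) :: [seq (fun e : nat -> nat => e i) | i <- iota 2 m].
have [r hr] : computable m.+2 (fun e => F (nth 0 [seq g e | g <- gs] 0)
     (fun i => nth 0 [seq g e | g <- gs] i.+1)).
  apply: (computable_comp (gs := gs) _ hF); first by rewrite /= size_map size_iota.
  by split; [exact: computable_var | exact: foldr_computable_var].
exists r => xs; case: xs hr => [|a [|b xs]] // hr sx.
have /= := hr _ sx; congr eval; congr F.
rewrite -map_comp.
have -> : [seq ((fun g : (nat -> nat) -> nat => g (nth 0 [:: a, b & xs])) \o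
   (fun (i0 : nat) (e : nat -> nat) => e i0)) i | i <- iota 2 m] = xs.
  case: sx => sx; apply: (@eq_from_nth _ 0); first by rewrite size_map size_iota.
  move=> i; rewrite size_map size_iota => im.
  by rewrite (nth_map 0) ?size_iota // nth_iota //= add0n.
by [].
Qed.

Lemma computable_mul m f g :
  computable m f -> computable m g -> computable m (fun e => f e * g e).
Proof.
apply: (computable_fun2 (F := muln)).
apply: (@computable_ext _ (fun e => \sum_(i < e 1) e 0)).
  by move=> e; rewrite sum_nat_const card_ord mulnC.
by apply: (@computable_nsum 2 (fun e => e 1) (fun _ e => e 0)); apply: computable_var.
Qed.

Lemma computable_exp m f g :
  computable m f -> computable m g -> computable m (fun e => f e ^ g e).
Proof.
apply: (computable_fun2 (F := expn)).
apply: (@computable_ext _ (fun e => nrec 1 (fun _ y => e 0 * y) (e 1))).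
  by move=> e; elim: (e 1) => [|k /= ->]; rewrite ?expnS.
apply: (@computable_nrec 2 _ _ (fun _ y e => e 0 * y));
  [exact: computable_cst|exact: computable_var|].
by apply: computable_mul; apply: computable_var.
Qed.

(** * Decidable predicates and bounded quantifiers *)

Notation dec m P := (computable m (fun e => nat_of_bool (P e))) (only parsing).

Lemma dec_neg m P : dec m P -> dec m (fun e => ~~ P e).
Proof.
move=> hP; apply: (@computable_ext _ (fun e => 1 - P e)); first by move=> e; case: (P e).
by apply: computable_sub => //; apply: computable_cst.
Qed.

Lemma dec_and m P Q : dec m P -> dec m Q -> dec m (fun e => P e && Q e).
Proof.
move=> hP hQ; apply: (@computable_ext _ (fun e => P e * Q e)).
  by move=> e; case: (P e); case: (Q e).
exact: computable_mul.
Qed.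

Lemma dec_or m P Q : dec m P -> dec m Q -> dec m (fun e => P e || Q e).
Proof.
move=> hP hQ; apply: (@computable_ext _ (fun e => ~~ (~~ P e && ~~ Q e))).
  by move=> e; rewrite negb_and !negbK.
by apply: dec_neg; apply: dec_and; apply: dec_neg.
Qed.

Lemma dec_leq m f g : computable m f -> computable m g -> dec m (fun e => f e <= g e).
Proof.
move=> hf hg; apply: (@computable_ext _ (fun e => 1 - (f e - g e))).
  by move=> e; rewrite -subn_eq0; case: (f e - g e).
by apply: computable_sub; [exact: computable_cst | exact: computable_sub].
Qed.

Lemma dec_eq m f g : computable m f -> computable m g -> dec m (fun e => f e == g e).
Proof.
move=> hf hg; apply: (@computable_ext _ (fun e => (f e <= g e) && (g e <= f e))).
  by move=> e; rewrite eqn_leq.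
by apply: dec_and; apply: dec_leq.
Qed.

Definition bex k (P : nat -> bool) := [exists i : 'I_k, P i].
Definition ball k (P : nat -> bool) := [forall i : 'I_k, P i].

Lemma bexP k (P : nat -> bool) : reflect (exists2 i, i < k & P i) (bex k P).
Proof.
apply: (iffP existsP) => [[i Pi]|[i ik Pi]]; first by exists i.
by exists (Ordinal ik).
Qed.

Lemma ballP k (P : nat -> bool) : reflect (forall i, i < k -> P i) (ball k P).
Proof.
apply: (iffP forallP) => [h i ik|h i]; first exact: (h (Ordinal ik)).
exact: h.
Qed.

Lemma dec_bex m k (P : nat -> (nat -> nat) -> bool) :
  computable m k -> dec m.+1 (fun e => P (e 0) (fun i => e i.+1)) ->
  dec m (fun e => bex (k e) (fun i => P i e)).
Proof.
move=> hk hP; apply: (@computable_ext _ (fun e => ~~ (\sum_(i < k e) nat_of_bool (P i e)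
  <= 0))).
  move=> e; congr nat_of_bool; rewrite leqn0 sum_nat_eq0.
  rewrite negb_forall; apply: eq_existsb => i; rewrite /=.
  by case: (P i e).
apply: dec_neg; apply: dec_leq; last exact: computable_cst.
exact: (@computable_nsum m k (fun i e => P i e)).
Qed.

Lemma dec_ball m k (P : nat -> (nat -> nat) -> bool) :
  computable m k -> dec m.+1 (fun e => P (e 0) (fun i => e i.+1)) ->
  dec m (fun e => ball (k e) (fun i => P i e)).
Proof.
move=> hk hP; apply: (@computable_ext _ (fun e => ~~ bex (k e) (fun i => ~~ P i e))).
  by move=> e; rewrite negb_exists; congr nat_of_bool; apply: eq_forallb => i;
    rewrite negbK.
by apply: dec_neg; apply: (@dec_bex m k (fun i e => ~~ P i e)) => //; apply: dec_neg.
Qed.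

Lemma computable_div m f g :
  computable m f -> computable m g -> computable m (fun e => f e %/ g e).
Proof.
apply: (computable_fun2 (F := divn)).
(* The quotient counts the positive multiples of the divisor up to the dividend; the test [1 <= e 1]
   makes division by 0 yield 0. *)
apply: (@computable_ext _ (fun e => \sum_(k < e 0)
    nat_of_bool ((1 <= e 1) && (e 1 * k.+1 <= e 0)))).
  move=> e; case: (posnP (e 1)) => [->|d0].
    by rewrite divn0 big1.
  have E N : \sum_(k < N) nat_of_bool (e 1 * k.+1 <= e 0) = minn N (e 0 %/ e 1).
    elim: N => [|N IH]; first by rewrite big_ord0 min0n.
    rewrite big_ord_recr /= IH mulnC -leq_divRL //.
    by case: leqP; lia.
  by rewrite /= E; apply/minn_idPr; exact: leq_div.
apply: (@computable_nsum 2 (fun e => e 0) (fun k e => nat_of_bool ((1 <= e 1) && (e 1 *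
  k.+1 <= e 0)))).
  exact: computable_var.
apply: dec_and; apply: dec_leq; try exact: computable_var; first exact: computable_cst.
by apply: computable_mul; [exact: computable_var|apply: computable_succ;
  exact: computable_var].
Qed.

Lemma computable_mod m f g :
  computable m f -> computable m g -> computable m (fun e => f e %% g e).
Proof.
move=> hf hg; apply: (@computable_ext _ (fun e => f e - f e %/ g e * g e)).
  by move=> e; rewrite [X in X - _](divn_eq (f e) (g e)) addKn.
by apply: computable_sub => //; apply: computable_mul => //; apply: computable_div.
Qed.

(* [CodeSeq.code (x :: l)] is [2 ^ x * (2 * CodeSeq.code l + 1)]: the head is the
   2-adic valuation. *)
Definition code_head c := \sum_(k < c) (2 ^ k.+1 * (c %/ 2 ^ k.+1) == c).
Definition code_tail c := (c %/ 2 ^ code_head c) %/ 2.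
Definition code_nth c i := code_head (nrec c (fun _ y => code_tail y) i).

Lemma computable_head m f : computable m f -> computable m (fun e => code_head (f e)).
Proof.
apply: computable_fun1.
apply: (@computable_nsum 1 (fun e => e 0) (fun k e => nat_of_bool (2 ^ k.+1 * (e 0 %/ 2 ^
  k.+1) == e 0))).
  exact: computable_var.
have h : computable 2 (fun e => 2 ^ (e 0).+1).
  by apply: computable_exp; [exact: computable_cst|apply: computable_succ;
    exact: computable_var].
apply: dec_eq; last exact: computable_var.
by apply: computable_mul => //; apply: computable_div => //; exact: computable_var.
Qed.

Lemma computable_tail m f : computable m f -> computable m (fun e => code_tail (f e)).
Proof.
move=> hf; apply: computable_div; last exact: computable_cst.
apply: computable_div => //; apply: computable_exp; first exact: computable_cst.
exact: computable_head.
Qed.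

Lemma computable_code_nth m f g :
  computable m f -> computable m g -> computable m (fun e => code_nth (f e) (g e)).
Proof.
apply: (computable_fun2 (F := code_nth)).
apply: (@computable_head _ (fun e => _)).
apply: (@computable_nrec 2 _ _ (fun _ y _ => code_tail y)); try exact: computable_var.
by apply: computable_tail; exact: computable_var.
Qed.

Lemma code_head_cons x m : code_head (2 ^ x * m.*2.+1) = x.
Proof.
set c := 2 ^ x * _.
have xc : x <= c.
  by apply: leq_trans (ltnW (ltn_expl x (isT : 1 < 2))) _; rewrite leq_pmulr.
have E k : (2 ^ k.+1 * (c %/ 2 ^ k.+1) == c) = (k < x).
  rewrite mulnC -dvdn_eq /c; case: (ltnP k x) => kx.
    by rewrite dvdn_mulr // dvdn_exp2l.
  apply/negbTE; apply/negP => /(dvdn_trans (dvdn_exp2l 2 (_ : x.+1 <= k.+1))) - /(_ kx).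
  by rewrite expnSr dvdn_pmul2l ?expn_gt0 // dvdn2 /= odd_double.
rewrite /code_head (eq_bigr (fun k : 'I_c => nat_of_bool (k < x))) => [|k _];
  last by rewrite E.
rewrite -(big_mkord xpredT (fun k => nat_of_bool (k < x))).
rewrite (big_cat_nat (n := x)) //= (eq_big_nat _ _ (F2 := fun=> 1)) => [|i /andP[_ ->] //].
rewrite sum_nat_const_nat subn0 muln1 big_nat_cond big1 ?addn0 // => i /andP[/andP[xi _] _].
by rewrite ltnNge xi.
Qed.

Lemma code_tail_cons x m : code_tail (2 ^ x * m.*2.+1) = m.
Proof. by rewrite /code_tail code_head_cons mulKn ?expn_gt0 // divn2 /= uphalf_double. Qed.

(** Holds beyond the end of [l] too: the empty list has code 0, and head and tail of 0 are 0, the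
    default of [nth]. *)
Lemma code_nthE l i : code_nth (CodeSeq.code l) i = nth 0 l i.
Proof.
have tail0 : code_tail 0 = 0 by rewrite /code_tail div0n.
have comm c k : nrec c (fun _ y => code_tail y) k.+1 =
    nrec (code_tail c) (fun _ y => code_tail y) k.
  by elim: k => //= k ->.
rewrite /code_nth; elim: l i => [|x l IH] i.
  rewrite nth_nil (_ : nrec _ _ _ = 0); first by rewrite /code_head big_ord0.
  by elim: i => //= i ->.
case: i => [|i]; first by rewrite /= code_head_cons.
by rewrite comm /= code_tail_cons IH.
Qed.

(** * Finite automata on padded words *)

(* Words are written least significant letter first, so that reading the most
   significant letter first is a [foldr]. The zero letter z fixes the initial
   state: padding a word with leading zeros does not change its run. *)
Definition recog (S : Type) (z : S) (N : nat) (R : seq S -> Prop) : Prop :=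
  exists (Q : finType) (s0 : Q) (step : S -> Q -> Q) (fin : pred Q),
    [/\ #|Q| <= N, step z s0 = s0 & forall w, R w <-> fin (foldr step s0 w)].

(** Pigeonhole on the states reached after the suffixes of w, since the run starts at the right end:
    the letters between two equal states can be cut out. *)
Lemma run_short (S : Type) (Q : finType) (step : S -> Q -> Q) s0 w :
  exists2 w', size w' < #|Q| & foldr step s0 w' = foldr step s0 w.
Proof.
have [m] := ubnP (size w); elim: m => // m IH in w *; rewrite ltnS => wm.
have [|Qw] := ltnP (size w) #|Q|; first by exists w.
pose f (i : 'I_(size w).+1) := foldr step s0 (drop i w).
have /injectivePn[i [j ij fij]] : ~~ injectiveb f.
  apply/negP => /injectiveP /leq_card; rewrite card_ord => /leq_trans/(_ Qw);
    by rewrite ltnn.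
wlog lt_ij : i j ij fij / i < j.
  move=> W; have := ij; rewrite -val_eqE neq_ltn => /orP[|]; first exact: (W i j).
  by apply: (W j i); rewrite // eq_sym.
have jw : j <= size w by rewrite -ltnS.
have [|w' sw' Ew'] := IH (take i w ++ drop j w).
  rewrite size_cat size_take size_drop (leq_trans lt_ij jw).
  clear -lt_ij jw wm; lia.
exists w' => //; rewrite Ew' -[X in _ = foldr _ _ X](cat_take_drop i w) !foldr_cat.
by congr foldr; rewrite /f in fij.
Qed.

Section Recog.
Variables (S X : Type) (z : S) (zx : X).
Implicit Types (R : seq S -> Prop) (w : seq S).

Lemma run_pad (Q : Type) (s0 : Q) (step : S -> Q -> Q) w k :
  step z s0 = s0 -> foldr step s0 (w ++ nseq k z) = foldr step s0 w.
Proof.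
move=> zs; rewrite foldr_cat; congr foldr.
by elim: k => //= k ->.
Qed.

Lemma recog_pad N R w k : recog z N R -> R (w ++ nseq k z) <-> R w.
Proof.
by move=> [Q [s0 [step [fin [_ zs hR]]]]]; rewrite !hR run_pad.
Qed.

Lemma recog_ext N R R' : (forall w, R w <-> R' w) -> recog z N R -> recog z N R'.
Proof.
move=> RR' [Q [s0 [step [fin [cQ zs hR]]]]]; exists Q, s0, step, fin; split=> // w.
by rewrite -RR'.
Qed.

Lemma recog_not N R : recog z N R -> recog z N (fun w => ~ R w).
Proof.
move=> [Q [s0 [step [fin [cQ zs hR]]]]]; exists Q, s0, step, (predC fin); split=> // w.
by rewrite /= hR; split=> /negP.
Qed.

Lemma recog_and N N' R R' : recog z N R -> recog z N' R' ->
  recog z (N * N') (fun w => R w /\ R' w).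
Proof.
move=> [Q [s0 [step [fin [cQ zs hR]]]]] [Q' [s0' [step' [fin' [cQ' zs' hR']]]]].
exists (Q * Q')%type, (s0, s0'), (fun a s => (step a s.1, step' a s.2)).
exists (fun s => fin s.1 && fin' s.2); split=> [| |w].
- by rewrite card_prod leq_mul.
- by rewrite /= zs zs'.
have -> : foldr (fun a s => (step a s.1, step' a s.2)) (s0, s0') w =
    (foldr step s0 w, foldr step' s0' w) by elim: w => //= a w ->.
by rewrite /= hR hR'; split=> [[-> ->]|/andP].
Qed.

Lemma recog_map (h : X -> S) N R : h zx = z -> recog z N R ->
  recog zx N (fun v => R (map h v)).
Proof.
move=> hz [Q [s0 [step [fin [cQ zs hR]]]]].
exists Q, s0, (fun a => step (h a)), fin; split=> //; first by rewrite hz.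
by move=> v; rewrite hR foldr_map.
Qed.

Definition extend (R : seq (S * X) -> Prop) k w :=
  exists2 x : seq X, size x = size w + k & R (zip (w ++ nseq k z) x).

(** Subset construction. Its initial state consists of all states reachable while the first track
    reads zeros, which accounts for witnesses longer than w and makes it invariant under reading
    [z]. *)
Lemma recog_ex N (R : seq (S * X) -> Prop) : recog (z, zx) N R ->
  recog z (2 ^ N) (fun w => exists k, extend R k w).
Proof.
move=> [Q [s0 [step [fin [cQ zs hR]]]]].
pose T w := [set q : Q | `[< exists k, exists2 x : seq X, size x = size w + k &
  q = foldr step s0 (zip (w ++ nseq k z) x) >]]%SET.
pose st a (A : {set Q}) := [set q : Q | `[< exists2 p, p \in A & exists b, q =
  step (a, b) p >]]%SET.
have TS a w : T (a :: w) = st a (T w).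
  apply/setP => q; rewrite !inE; apply/asboolP/asboolP.
    move=> [k [[//|b x] /= [sx] ->]].
    exists (foldr step s0 (zip (w ++ nseq k z) x)); last by exists b.
    by rewrite inE; apply/asboolP; exists k, x.
  move=> [p]; rewrite inE => /asboolP[k [x sx ->]] [b ->].
  by exists k, (b :: x) => //=; rewrite sx.
exists ({set Q} : finType), (T [::]), st, (fun A : {set Q} => [exists q in A, fin q]);
  split.
- by rewrite -cardsT -powersetT card_powerset cardsT leq_exp2l.
- rewrite -TS; apply/setP => q; rewrite !inE; apply/asboolP/asboolP.
    by move=> [k [x sx ->]]; exists k.+1, x.
  (* A letter [zx] added on the most significant side lengthens the witness without affecting the
     run. *)
  move=> [k [x sx ->]]; exists k, (rcons x zx); first by rewrite size_rcons sx.
  have -> : zip ([:: z] ++ nseq k z) (rcons x zx) = rcons (zip (nseq k z) x) (z, zx).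
    rewrite -zip_rcons; last by rewrite size_nseq sx.
    by congr zip; rewrite -[_ ++ _]/(nseq k.+1 z) -addn1 nseqD cats1.
  by rewrite foldr_rcons zs.
move=> w; have -> : foldr st (T [::]) w = T w by elim: w => //= a w ->.
split.
  move=> [k [x sx /hR fx]]; apply/existsP; exists (foldr step s0 (zip (w ++ nseq k z) x)).
  by rewrite fx andbT inE; apply/asboolP; exists k, x.
move=> /existsP[q /andP[]]; rewrite inE => /asboolP[k [x sx ->]] /hR fx.
by exists k, x.
Qed.

Lemma recog_short N R : recog z N R -> (exists w, R w) -> exists2 w, size w < N & R w.
Proof.
move=> [Q [s0 [step [fin [cQ zs hR]]]]] [w /hR fw].
have [w' sw' Ew'] := run_short step s0 w.
by exists w'; [exact: leq_trans sw' cQ | apply/hR; rewrite Ew'].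
Qed.

(** Pumping restricted to the padding: there the first track is constantly [z], so the top part of
    the witness is shortened while w and the letters beside it stay. *)
Lemma recog_extend_short N (R : seq (S * X) -> Prop) k w :
  recog (z, zx) N R -> extend R k w -> exists2 k', k' < N & extend R k' w.
Proof.
move=> [Q [s0 [step [fin [cQ zs hR]]]]] [x sx /hR].
rewrite -(cat_take_drop (size w) x) zip_cat; last first.
  by rewrite size_take sx; case: ltnP; lia.
rewrite foldr_cat.
have -> q : foldr step q (zip (nseq k z) (drop (size w) x)) =
    foldr (fun b => step (z, b)) q (drop (size w) x).
  have : size (drop (size w) x) = k by rewrite size_drop sx addKn.
  by elim: (drop _ x) k {sx} => [|b y IH] [|k] //= [/IH ->].
have [y sy <-] := run_short (fun b => step (z, b)) s0 (drop (size w) x).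
move=> fy; exists (size y); first exact: leq_trans sy cQ.
exists (take (size w) x ++ y).
  by rewrite size_cat size_take sx; case: ltnP; lia.
apply/hR; rewrite zip_cat; last by rewrite size_take sx; case: ltnP; lia.
rewrite foldr_cat; move: fy; congr fin; congr foldr.
by elim: y {sy} => //= b y ->.
Qed.
End Recog.

Lemma recog_forall (S : Type) (z : S) N n (R : 'I_n -> seq S -> Prop) :
  (forall j, recog z N (R j)) -> recog z (N ^ n) (fun w => forall j, R j w).
Proof.
move=> hR.
suff: recog z (N ^ size (enum 'I_n)) (fun w => forall j, j \in enum 'I_n -> R j w).
  rewrite size_enum_ord; apply: recog_ext => w.
  by split=> h j; [apply: h; rewrite mem_enum | move=> _; apply: h].
elim: (enum 'I_n) => [|j js IH].
  by exists unit, tt, (fun _ _ => tt), xpredT; split; rewrite ?card_unit.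
rewrite expnS; apply: recog_ext (recog_and (hR j) IH) => w; split.
  by move=> [h1 h2] i; rewrite inE => /orP[/eqP->|/h2].
by move=> h; split=> [|i ij]; apply: h; rewrite inE ?eqxx ?ij ?orbT.
Qed.

(** * Words of value zero in a Pisot system *)

Section Pisot.
Import Order.TTheory GRing.Theory Num.Theory.
Local Open Scope ring_scope.

(** The minimal polynomial is separable: in characteristic 0 its derivative is non-zero of smaller
    degree, hence does not vanish at x. *)
Lemma minCpoly_simple_root x g :
  minCpoly x = ('X - x%:P) * g -> g.[x] != 0.
Proof.
move=> Dg; have [p [Dp mon_p] dv_p] := minCpolyP x.
have sp : (1 < size p)%N by rewrite -(size_map_poly (ratr : {rmorphism rat ->
  algC})) -Dp size_minCpoly.
have : ~~ root (map_poly ratr p^`()) x.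
  rewrite dv_p gtNdvdp ?lt_size_deriv ?(monic_neq0 mon_p) //.
  apply/eqP => /(congr1 (fun q : {poly rat} => q`_(size p).-2)).
  rewrite coef_deriv coef0 (_ : (size p).-2.+1 = (size p).-1); last by lia.
  rewrite -lead_coefE (monicP mon_p) => /eqP.
  by rewrite pnatr_eq0; lia.
rewrite -deriv_map -Dp Dg derivM derivXsubC /root !hornerE subrr mul0r addr0.
by [].
Qed.

(** The polynomial g in the shift operator, applied to the sequence f; factoring g factors the
    operator. *)
Definition shiftop (g : {poly algC}) (f : nat -> algC) (m : nat) : algC :=
  \sum_(j < size g) g`_j * f (m + j)%N.

Lemma shiftop_widen N (g : {poly algC}) f m : (size g <= N)%N ->
  shiftop g f m = \sum_(j < N) g`_j * f (m + j)%N.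
Proof.
move=> sN; rewrite /shiftop (big_ord_widen N (fun j => g`_j * f (m + j)%N)) //.
rewrite big_mkcond; apply: eq_bigr => j _; case: ltnP => // gj.
by rewrite nth_default ?mul0r.
Qed.

Lemma shiftop_XsubC y g f m :
  shiftop (('X - y%:P) * g) f m = shiftop g f m.+1 - y * shiftop g f m.
Proof.
rewrite (@shiftop_widen (size g).+1); last first.
  apply: leq_trans (size_polyMleq _ _) _; rewrite size_XsubC addSn /= add1n //.
rewrite [shiftop g f m](@shiftop_widen (size g).+1) // mulr_sumr.
rewrite (eq_bigr (fun j : 'I_(size g).+1 => ('X * g)`_j * f (m + j)%N - y * (g`_j * f (m +
  j)%N))).
  rewrite sumrB; congr (_ - _); rewrite big_ord_recl coefXM /= mul0r add0r.
  by apply: eq_bigr => j _; rewrite coefXM /= /bump /= add1n addnS addSn.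
by move=> j _; rewrite mulrBl coefB mulrBl mulrA; congr (_ - _ * _); rewrite coefCM.
Qed.

Definition summable (f : nat -> algC) :=
  exists B : algC, forall M, \sum_(m < M) `|f m| <= B.

(** Summing |h(m+1)| <= |y| |h(m)| + |h(m+1) - y h(m)| bounds a partial sum S by |h(0)| + |y| S + B,
    which is solved for S as |y| < 1. *)
Lemma summable_step y (h : nat -> algC) : `|y| < 1 ->
  summable (fun m => h m.+1 - y * h m) -> summable h.
Proof.
move=> y1 [B hB]; have y1' : 0 < 1 - `|y| by rewrite subr_gt0.
exists ((`|h 0%N| + B) / (1 - `|y|)) => M; rewrite ler_pdivlMr //.
set S := \sum_(m < M) `|h m|.
suff : S <= `|h 0%N| + (`|y| * S + B) by rewrite mulrBr mulr1 lerBlDr -addrA [B + _]addrC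
  [S * _]mulrC.
have B0 : 0 <= B by have := hB 0%N; rewrite big_ord0.
rewrite /S; case: M {S} => [|M]; first by rewrite big_ord0 mulr0 add0r addr_ge0.
rewrite {1}big_ord_recl /= lerD2l.
apply: (@le_trans _ _ (\sum_(m < M) (`|y| * `|h m| + `|h m.+1 - y * h m|))).
  apply: ler_sum => m _; rewrite /bump /= add1n.
  by rewrite -{1}[h m.+1](subrK (y * h m)) addrC -normrM ler_normD.
rewrite big_split /= -mulr_sumr; apply: lerD; last exact: hB.
by rewrite ler_wpM2l // big_ord_recr /= lerDl.
Qed.

Lemma summable_of_roots (r : seq algC) f : (forall y, y \in r -> `|y| < 1) ->
  summable (shiftop (\prod_(y <- r) ('X - y%:P)) f) -> summable f.
Proof.
elim: r => [|y r IH] hr.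
  rewrite big_nil => -[B hB]; exists B => M; apply: le_trans (hB M).
  apply: ler_sum => m _.
  by rewrite /shiftop size_poly1 big_ord1 coef1 mul1r addn0.
rewrite big_cons => h; apply: IH => [z zr|]; first by apply: hr; rewrite inE zr orbT.
apply: (@summable_step y); first by apply: hr; rewrite inE eqxx.
by case: h => B hB; exists B => M; apply: le_trans (hB M); apply: ler_sum => m _;
  rewrite shiftop_XsubC.
Qed.

(** Write the minimal polynomial as (X - x) g. Applying g to U gives a sequence killed by X - x,
    hence geometric. Subtracting the right multiple of x^m from U leaves a sequence killed by g,
    whose roots all have modulus below 1. *)
Lemma pisot_asymptotics U : pisot_system U ->
  exists th c : algC, exists e : nat -> algC,
    [/\ 1 < th, forall m, (U m)%:R = c * th ^+ m + e m & summable e].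
Proof.
case=> _ _ [x [_ _ x1 hx] hU].
have [r Dr] := closed_field_poly_normal (minCpoly x).
rewrite (monicP (minCpoly_monic x)) scale1r in Dr.
have xr : x \in r by rewrite -root_prod_XsubC -Dr root_minCpoly.
have Dp : minCpoly x = ('X - x%:P) * \prod_(y <- rem x r) ('X - y%:P).
  by rewrite Dr (perm_big _ (perm_to_rem xr)) big_cons.
set g := \prod_(y <- rem x r) _ in Dp.
have gx := minCpoly_simple_root Dp.
pose V := shiftop g (fun m => (U m)%:R).
have VS m : V m.+1 = x * V m.
  by apply/eqP; rewrite -subr_eq0 -shiftop_XsubC -Dp; apply/eqP/hU.
have VE m : V m = V 0%N * x ^+ m.
  by elim: m => [|m IH]; rewrite ?expr0 ?mulr1 // VS IH exprS mulrCA.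
(* The operator g sends x^m to g(x) x^m, so this c makes it annihilate the remainder; g(x) is
   non-zero as x is a simple root. *)
pose c := V 0%N / g.[x].
exists x, c, (fun m => (U m)%:R - c * x ^+ m); split=> // [m|].
  by rewrite addrC subrK.
apply: (@summable_of_roots (rem x r)).
  move=> y yr; apply: hx.
    by rewrite Dr root_prod_XsubC (mem_rem yr).
  apply: contra_neq gx => yx; apply/eqP; rewrite -/(root g x) root_prod_XsubC.
  by rewrite -{1}yx.
exists 0 => M; rewrite big1 // => m _; apply/eqP; rewrite normr_eq0 /shiftop.
rewrite -/g; under eq_bigr do rewrite mulrBr.
rewrite sumrB -/(shiftop g (fun m => (U m)%:R) m) -/V VE.
suff -> : \sum_(j < size g) g`_j * (c * x ^+ (m + j)) = c * x ^+ m * g.[x].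
  by rewrite mulrAC divfK // subrr.
by rewrite horner_coef mulr_sumr; apply: eq_bigr => j _; rewrite exprD; ring.
Qed.

Lemma algC_nat_bound (x : algC) : 0 <= x -> exists K : nat, x <= K%:R.
Proof. by move=> x0; exists (Num.bound x); apply/ltW/archi_boundP. Qed.

Lemma summable_term (e : nat -> algC) B m :
  (forall M, \sum_(i < M) `|e i| <= B) -> `|e m| <= B.
Proof. by move=> hB; apply: le_trans (hB m.+1); rewrite big_ord_recr /= lerDr sumr_ge0. Qed.

(** The difference U_(i+1) - th U_i = e_(i+1) - th e_i is bounded, and U_i >= 1 absorbs an additive
    constant. This ratio will bound the greedy digits. *)
Lemma pisot_ratio U : pisot_system U -> exists C, forall i, (U i.+1 <= C * U i)%N.
Proof.
move=> pU; have [th [c [e [th1 hU [B hB]]]]] := pisot_asymptotics pU.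
have th0 : 0 <= th by apply: le_trans (ltW th1).
have B0 : 0 <= B by have := hB 0%N; rewrite big_ord0.
have [C hC] : exists C : nat, th + (B + th * B) <= C%:R.
  by apply: algC_nat_bound; rewrite !addr_ge0 // mulr_ge0.
exists C => i; have Ui : (0 < U i)%N.
  by case: pU => U0 Uinc _; case: i => [|i]; rewrite ?U0 //; apply: leq_ltn_trans (Uinc i).
rewrite -(ler_nat algC) natrM; apply: le_trans (_ : (th + (B + th * B)) * (U i)%:R <= _);
  last first.
  by rewrite ler_wpM2r.
have -> : (U i.+1)%:R = th * (U i)%:R + (e i.+1 - th * e i).
  by rewrite !hU exprS mulrDr addrACA mulrCA -addrA subrr addr0; congr (_ + _);
    rewrite ?mulrA.
rewrite mulrDl lerD2l; apply: le_trans (_ : B + th * B <= _); last first.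
  by rewrite -[leLHS]mulr1 ler_wpM2l ?ler1n // addr_ge0 // mulr_ge0.
have rE : e i.+1 - th * e i \is Num.real.
  rewrite (_ : _ - _ = (U i.+1)%:R - th * (U i)%:R); last first.
    by rewrite !hU exprS mulrDr opprD addrACA mulrCA subrr add0r.
  by rewrite realB ?realM ?realn ?ger0_real.
apply: le_trans (real_ler_norm rE) _.
apply: le_trans (ler_normB _ _) _; rewrite lerD ?(summable_term _ hB) //.
by rewrite normrM ger0_norm // ler_wpM2l // (summable_term _ hB).
Qed.

(** The minimal polynomial of an algebraic integer is monic with integer coefficients; its degree is
    at least 1, hence the form [d.+1]. *)
Lemma pisot_recurrence U : pisot_system U ->
  exists d, exists a : nat -> int, forall i,
    (U (i + d.+1)%N)%:Z = \sum_(j < d.+1) a j * (U (i + j)%N)%:Z.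
Proof.
case=> _ _ [x [Ax _ _ _] hU].
have [q Dq] := floorpP Ax.
have sq : size (minCpoly x) = size q by rewrite Dq size_map_inj_poly //; apply: intr_inj.
have s1 := size_minCpoly x; exists (size q).-2, (fun j => - q`_j) => i.
have lq : q`_(size q).-1 = 1.
  apply: (@intr_inj algC); rewrite -coef_map -Dq -sq -lead_coefE.
  by rewrite (monicP (minCpoly_monic x)).
have := hU i; rewrite sq (_ : size q = (size q).-2.+2); last by rewrite sq in s1; lia.
rewrite (_ : (size q).-2.+1 = (size q).-1) in lq *; last by rewrite sq in s1; lia.
rewrite big_ord_recr /= => h; apply: (@intr_inj algC); rewrite rmorph_sum /=.
move: h; rewrite Dq coef_map /= lq mul1r => /eqP; rewrite addrC addr_eq0 => /eqP.
rewrite -pmulrn => ->; rewrite -sumrN; apply: eq_bigr => j _.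
by rewrite coef_map /= rmorphM rmorphN /= mulNr.
Qed.

(** The shift i serves to read a word from its most significant end: a new lowest letter turns the
    values of w at [i.+1] into values at i, and those for i <= d form the state of the automaton. *)
Definition wval (U : nat -> nat) (i : nat) (w : seq int) : int :=
  \sum_(j < size w) w`_j * (U (j + i)%N)%:Z.

Lemma wval_cons U i z w : wval U i (z :: w) = z * (U i)%:Z + wval U i.+1 w.
Proof.
rewrite /wval /= big_ord_recl /= add0n; congr (_ + _).
by apply: eq_bigr => j _; rewrite /bump /= add1n addSnnS.
Qed.

Lemma wval_cat U i v u : wval U i (v ++ u) = wval U i v + wval U (size v + i) u.
Proof.
elim: v i => [|z v IH] i /=; first by rewrite /wval big_ord0 add0r add0n.
by rewrite !wval_cons IH addrA addSnnS.
Qed.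

Lemma wval_recurrence U d (a : nat -> int) w :
  (forall i, (U (i + d.+1)%N)%:Z = \sum_(j < d.+1) a j * (U (i + j)%N)%:Z) ->
  wval U d.+1 w = \sum_(j < d.+1) a j * wval U j w.
Proof.
move=> hU; rewrite /wval; under eq_bigr do rewrite hU mulr_sumr.
rewrite exchange_big; apply: eq_bigr => j _ /=; rewrite mulr_sumr.
by apply: eq_bigr => k _; rewrite mulrCA.
Qed.

Lemma geometric_sum_le (th : algC) k : 1 < th ->
  \sum_(j < k) th ^+ j <= th ^+ k / (th - 1).
Proof.
move=> th1; have th0 : 0 < th - 1 by rewrite subr_gt0.
by rewrite ler_pdivlMr // mulrC -subrX1 lerBlDr lerDl ler01.
Qed.

(* The dominant part of a word with zero value is bounded in terms of the
   digits still to come, and all the other conjugates contribute a bounded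
   amount. *)
Lemma pisot_bound U (d B : nat) : pisot_system U ->
  exists K : nat, forall v u : seq int,
    (forall x, x \in v ++ u -> `|x| <= B%:Z) ->
    wval U 0 (v ++ u) = 0 -> forall i, (i <= d)%N -> `|wval U i u| <= K%:Z.
Proof.
move=> pU; have [th [c [e [th1 hU [E hE]]]]] := pisot_asymptotics pU.
have th0 : 0 <= th by apply: le_trans (ltW th1).
have tm0 : 0 < th - 1 by rewrite subr_gt0.
have E0 : 0 <= E by have := hE 0%N; rewrite big_ord0.
(* This will bound [c * pw u]: a geometric sum for the dominant part of v, plus two approximation
   errors. *)
pose Y : algC := `|c| * B%:R / (th - 1) + 2 * (B%:R * E).
have Y0 : 0 <= Y by rewrite addr_ge0 ?mulr_ge0 ?invr_ge0 // ltW.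
have [K hK] : exists K : nat, th ^+ d * Y + B%:R * E <= K%:R.
  by apply: algC_nat_bound; rewrite addr_ge0 ?mulr_ge0 ?exprn_ge0.
exists K => v u hB val0 i id.
have hdig (w : seq int) j : {subset w <= v ++ u} -> (j < size w)%N ->
  `|(w`_j)%:~R : algC| <= B%:R.
  move=> sw jw; rewrite -intr_norm (_ : B%:R = B%:Z%:~R) // ler_int.
  by apply/hB/sw/mem_nth.
pose pw (w : seq int) : algC := \sum_(j < size w) (w`_j)%:~R * th ^+ j.
have approx (w : seq int) k : {subset w <= v ++ u} ->
    `|(wval U k w)%:~R - c * (th ^+ k * pw w)| <= B%:R * E.
  move=> sw; rewrite /wval rmorph_sum /= /pw !mulr_sumr -sumrB.
  rewrite (eq_bigr (fun j : 'I_(size w) => (w`_j)%:~R * e (j + k)%N)); last first.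
    move=> j _; rewrite rmorphM /= -pmulrn hU exprD; ring.
  apply: le_trans (ler_norm_sum _ _ _) _.
  apply: (@le_trans _ _ (\sum_(j < size w) B%:R * `|e (j + k)%N|)).
    by apply: ler_sum => j _; rewrite normrM ler_wpM2r // hdig.
  rewrite -mulr_sumr ler_wpM2l // (le_trans _ (hE (k + size w)%N)) //.
  rewrite big_split_ord /= (eq_bigr (fun j : 'I_(size w) => `|e (k + j)%N|)).
    by rewrite lerDr sumr_ge0.
  by move=> j _; rewrite addnC.
have svu : {subset u <= v ++ u} by move=> x xu; rewrite mem_cat xu orbT.
have svv : {subset v <= v ++ u} by move=> x xu; rewrite mem_cat xu.
have hY : `|c * pw u| <= Y.
  set k := size v.
  have thk : 1 <= th ^+ k by rewrite exprn_ege1 // ltW.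
  have thk0 : 0 < th ^+ k by apply: lt_le_trans thk.
  rewrite -(ler_pM2l thk0) -{1}(ger0_norm (ltW thk0)) -normrM mulrCA.
  have au := approx u k svu.
  have av := approx v 0%N svv.
  (* Here u is the part already read and v the lower digits still to come; as the total is zero,
     they cancel. *)
  have Euv : (wval U k u)%:~R = - (wval U 0 v)%:~R :> algC.
    by move: val0; rewrite wval_cat addn0 => /eqP; rewrite addrC addr_eq0 => /eqP ->;
      rewrite rmorphN.
  rewrite expr0 mul1r in av.
  have pv : `|c * pw v| <= `|c| * B%:R / (th - 1) * th ^+ k.
    rewrite normrM -!mulrA ler_wpM2l //; apply: le_trans (ler_norm_sum _ _ _) _.
    apply: (@le_trans _ _ (\sum_(j < size v) B%:R * th ^+ j)).
      apply: ler_sum => j _; rewrite normrM [`|th ^+ _|]ger0_norm ?exprn_ge0 //.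
      by rewrite ler_wpM2r ?exprn_ge0 // hdig.
    by rewrite -mulr_sumr ler_wpM2l // mulrC geometric_sum_le.
  have -> : c * (th ^+ k * pw u) = - ((wval U k u)%:~R - c * (th ^+ k * pw u))
      - ((wval U 0 v)%:~R - c * pw v) - c * pw v by rewrite Euv; ring.
  apply: le_trans (ler_normB _ _) _; rewrite mulrDr addrC.
  apply: lerD; first by rewrite [leRHS]mulrC.
  apply: le_trans (ler_normB _ _) _; rewrite normrN.
  apply: (@le_trans _ _ (2 * (B%:R * E))).
    by rewrite mulr_natl mulr2n lerD.
  by rewrite -[leLHS]mul1r ler_wpM2r ?mulr_ge0.
rewrite -(ler_int algC) intr_norm; apply: le_trans (_ : _ <= K%:R) _; last by [].
apply: le_trans hK; rewrite -[X in `|X|](subrK (c * (th ^+ i * pw u))) addrC.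
apply: le_trans (ler_normD _ _) _; apply: lerD; last exact: approx.
rewrite mulrCA normrM ger0_norm ?exprn_ge0 //.
apply: ler_pM => //; rewrite ?exprn_ge0 //.
by rewrite ler_weXn2l // ltW.
Qed.

(** A state is the vector of the d+1 shifted values of the part read while it stays in the box given
    by [pisot_bound]; leaving the box leads to the sink [None]. The number of states is uniform in
    the alphabet and in h. *)
Lemma recog_zero U (B : nat) : pisot_system U ->
  exists K, forall (S : Type) (z : S) (h : S -> int), h z = 0 ->
    (forall a, `|h a| <= B%:Z) ->
    recog z K (fun w => wval U 0 (map h w) = 0).
Proof.
move=> pU; have [d [a hU]] := pisot_recurrence pU.
have [K hK] := pisot_bound d B pU.
pose Q := {ffun 'I_d.+1 -> 'I_(K.*2.+1)}.
exists #|{: option Q}| => S z h hz hB.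
pose dcd (e : Q) (i : nat) : int := (e (inord i))%:Z - K%:Z.
pose box (v : nat -> int) := [forall i : 'I_d.+1, `|v i| <= K%:Z].
pose enc (v : nat -> int) : option Q :=
  if box v then Some [ffun i : 'I_d.+1 => inord (absz (v i + K%:Z))] else None.
(* Values at shift [i.+1]: the next coordinate, except for i = d, where the recurrence supplies
   it. *)
pose nxt (e : Q) (i : nat) : int :=
  if (i < d)%N then dcd e i.+1 else \sum_(j < d.+1) a j * dcd e j.
pose step (s : S) (o : option Q) : option Q :=
  if o is Some e then enc (fun i => h s * (U i)%:Z + nxt e i) else None.
pose v w i := wval U i (map h w).
have dcd_enc (f : nat -> int) e i : enc f = Some e -> (i <= d)%N -> dcd e i = f i.
  rewrite /enc; case: ifP => // /forallP bf [<-] id.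
  rewrite /dcd ffunE; have := bf (inord i); rewrite inordK // => fi.
  by rewrite inordK; lia.
pose s0 := enc (v [::]).
(* The run computes the true vectors as long as no suffix leaves the box; by [pisot_bound] this
   holds for every word of value zero. *)
pose inbox (w : seq S) := forall k, (k <= size w)%N -> box (v (drop k w)).
have vS s w : v (s :: w) = (fun i => h s * (U i)%:Z + v w i.+1).
  by apply: funext => i; rewrite /v /= wval_cons.
have stepE s w e : enc (v w) = Some e -> step s (Some e) = enc (v (s :: w)).
  move=> Ee; rewrite /step vS /enc.
  have nE i : (i <= d)%N -> nxt e i = v w i.+1.
    move=> id; rewrite /nxt; case: ltnP => di; first exact: dcd_enc Ee _.
    have -> : i = d by lia.
    rewrite [RHS](wval_recurrence _ hU); apply: eq_bigr => j _; congr (_ * _).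
    by apply: dcd_enc Ee _; rewrite -ltnS.
  have -> : box (fun i => h s * (U i)%:Z + nxt e i) =
    box (fun i => h s * (U i)%:Z + v w i.+1).
    by apply: eq_forallb => i; rewrite nE // -ltnS.
  case: ifP => // _; congr Some; apply/ffunP => i; rewrite !ffunE nE //.
  by rewrite -ltnS.
have box0 : box (v [::]) by apply/forallP => i; rewrite /v /wval big_ord0 normr0.
have run w : inbox w -> foldr step s0 w = enc (v w).
  elim: w => [//|s w IH] ib /=; rewrite IH; last by move=> k kw; apply: (ib k.+1).
  have := ib 1%N isT; rewrite /= drop0 => bw.
  by case E : (enc (v w)) => [e|]; [exact: stepE | move: E; rewrite /enc bw].
have run_box w e : foldr step s0 w = Some e -> inbox w.
  elim: w e => [|s w IH] e /=; first by move=> _ [].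
  case E : (foldr step s0 w) => [e'|] //; have ib := IH _ E.
  rewrite run // in E; rewrite (stepE _ _ _ E) /enc; case: ifP => // bs _.
  by case.
exists (option Q : finType), s0, step, (fun o => if o is Some e then dcd e 0%N == 0 else
  false).
split=> //.
  have [e Ee] : exists e, s0 = Some e by rewrite /s0 /enc box0; eexists.
  rewrite {1}Ee (stepE _ _ _ Ee) /s0; congr enc; rewrite vS hz.
  by apply: funext => i; rewrite mul0r add0r /v /wval !big_ord0.
move=> w; split=> [w0|].
  have ib : inbox w.
    move=> k kw; apply/forallP => i; rewrite /v map_drop.
    apply: (hK (take k (map h w))); rewrite ?cat_take_drop //; last by rewrite -ltnS.
    move=> x; elim: (w) => [|s w' IH] //=.
    by rewrite inE => /orP[/eqP->|/IH].
  rewrite run //; case E : (enc (v w)) => [e|].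
    by rewrite (dcd_enc _ _ _ E) // /v w0.
  by move: E; rewrite /enc; have := ib 0%N isT; rewrite drop0 => ->.
case E : (foldr step s0 w) => [e|] // /eqP.
have := run_box _ _ E => ib; rewrite run // in E.
by rewrite (dcd_enc _ _ _ E).
Qed.

End Pisot.

(** * One-invariance as a first-order property *)

Section Games.
Local Open Scope classical_set_scope.

(** The move from q to p would also lead from t to r inside P. The additive form avoids truncated
    subtraction and suits automata. *)
Definition bad_pair n (P : set (position n)) (q p : position n) : Prop :=
  exists r t, [/\ P r, P t & forall j, tnth t j + tnth p j = tnth r j + tnth q j].

Definition absorbing n (P : set (position n)) : Prop :=
  forall q, ~ P q -> exists p, [/\ P p, le_pos p q & ~ bad_pair P q p].

Lemma tnth_sub_pos n (p m : position n) j : tnth (sub_pos p m) j = tnth p j - tnth m j.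
Proof. by rewrite tnth_mktuple. Qed.

Lemma position_eq n (p q : position n) : (forall j, tnth p j = tnth q j) -> p = q.
Proof. exact: eq_from_tnth. Qed.

Definition pos_sum n (p : position n) := \sum_(j < n) tnth p j.

Lemma pos_sum_sub n (p m : position n) : m <> pos0 n -> le_pos m p ->
  pos_sum (sub_pos p m) < pos_sum p.
Proof.
move=> m0 mp; have E : pos_sum p = pos_sum (sub_pos p m) + pos_sum m.
  rewrite -big_split; apply: eq_bigr => j _ /=.
  by rewrite tnth_sub_pos subnK //; apply: mp.
rewrite E -[X in X < _]addn0 ltn_add2l lt0n; apply/eqP => /eqP.
rewrite sum_nat_eq0 => /forallP h; apply: m0; apply: position_eq => j.
by rewrite tnth_mktuple; apply/eqP/(h j).
Qed.

Lemma losing_or_winning n (G : game n) p : losing G p \/ winning G p.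
Proof.
have [k] := ubnP (pos_sum p); elim: k => // k IH in p *; rewrite ltnS => pk.
have [[m [Gm lm]]|h] := pselect (exists m, G p m /\ losing G (sub_pos p m)).
  by right; apply: Winning Gm lm.
left; apply: Losing => m Gm; have [m0 mp] := moves_valid Gm.
have [lm|//] := IH (sub_pos p m) (leq_trans (pos_sum_sub m0 mp) pk).
by case: h; exists m.
Qed.

Lemma losing_not_winning n (G : game n) p : losing G p -> ~ winning G p.
Proof.
have [k] := ubnP (pos_sum p); elim: k => // k IH in p *; rewrite ltnS => pk.
case=> lp; case=> m Gm lm; have [m0 mp] := moves_valid Gm.
exact: IH (leq_trans (pos_sum_sub m0 mp) pk) lm (lp m Gm).
Qed.

(* A move set realizing P avoids the differences of P, and enlarging it to all
   avoided differences keeps P absorbing. *)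
Lemma one_invariantP n (P : set (position n)) : one_invariant P <-> absorbing P.
Proof.
split=> [[G [I hI] ->] q nlq|aP].
  (* A winning move m from q leads to the required p; if the pair were bad, the same m would lead
     from t to r, both losing. *)
  have [//|[m Gm lm]] := losing_or_winning G q.
  have [m0 mq] := moves_valid Gm; exists (sub_pos q m); split=> //.
    by move=> j; rewrite tnth_sub_pos leq_subr.
  move=> [r [t [lr lt h]]].
  have tE j : tnth t j = tnth r j + tnth m j.
    have := h j; rewrite tnth_sub_pos; have := mq j; lia.
  have Gt : G t m.
    move: Gm; rewrite !hI => -[Im _]; split=> // j; rewrite tE; exact: leq_addl.
  have tm : sub_pos t m = r.
    by apply: position_eq => j; rewrite tnth_sub_pos tE addnK.
  by case: lt => /(_ m Gt); rewrite tm; apply: losing_not_winning.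
pose I : set (position n) := [set m | m <> pos0 n /\
  ~ exists r t, [/\ P r, P t & forall j, tnth t j = tnth r j + tnth m j]].
have hI p m : (I `&` [set m | le_pos m p]) m -> m <> pos0 n /\ le_pos m p.
  by case=> -[].
pose G := @Game n (fun p => I `&` [set m | le_pos m p]) hI.
exists G; first by exists I.
have main p : (P p -> losing G p) /\ (~ P p -> winning G p).
  have [k] := ubnP (pos_sum p); elim: k => // k IH in p *; rewrite ltnS => pk.
  split=> [Pp|nPp].
    apply: Losing => m [[m0 Im] mp].
    apply: (IH _ (leq_trans (pos_sum_sub m0 mp) pk)).2 => Ppm; apply: Im.
    exists (sub_pos p m), p; split=> // j; rewrite tnth_sub_pos subnK //.
  have [q [Pq qp nb]] := aP _ nPp.
  have pq j : tnth (sub_pos p (sub_pos p q)) j = tnth q j.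
    by rewrite !tnth_sub_pos subKn //; apply: qp.
  have m0 : sub_pos p q <> pos0 n.
    move=> E; apply: nPp; suff -> : p = q by [].
    apply: position_eq => j; rewrite -pq E tnth_sub_pos tnth_mktuple subn0 //.
  have mp : le_pos (sub_pos p q) p by move=> j; rewrite tnth_sub_pos leq_subr.
  apply: (@Winning _ _ _ (sub_pos p q)).
    split=> //; split=> // -[r [t [Pr Pt h]]]; apply: nb; exists r, t; split=> // j.
    by rewrite h tnth_sub_pos; have := qp j; lia.
  by rewrite (position_eq pq); apply: (IH q _).1 => //; rewrite -(position_eq pq);
    exact: leq_trans (pos_sum_sub m0 mp) pk.
apply/seteqP; split=> p; first exact: (main p).1.
move=> lp; apply: contrapT => /(main p).2; exact: losing_not_winning.
Qed.

End Games.

(** * Bounding the quantifiers *)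

Definition nval (U : nat -> nat) (i : nat) (w : seq nat) : nat :=
  \sum_(j < size w) nth 0 w j * U (j + i).

Lemma nval_nil U i : nval U i [::] = 0.
Proof. by rewrite /nval big_ord0. Qed.

Lemma nval_cons U i x w : nval U i (x :: w) = x * U i + nval U i.+1 w.
Proof.
rewrite /nval /= big_ord_recl /= add0n; congr (_ + _).
by apply: eq_bigr => j _; rewrite /bump /= add1n addSnnS.
Qed.

Lemma nval_cat U i v u : nval U i (v ++ u) = nval U i v + nval U (size v + i) u.
Proof.
elim: v i => [|x v IH] i /=; first by rewrite nval_nil.
by rewrite !nval_cons IH addnA addSnnS.
Qed.

Lemma nval_nseq0 U i k : nval U i (nseq k 0) = 0.
Proof. by elim: k i => [|k IH] i /=; rewrite ?nval_nil // nval_cons IH. Qed.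

Lemma nval_pad U i v k : nval U i (v ++ nseq k 0) = nval U i v.
Proof. by rewrite nval_cat nval_nseq0 addn0. Qed.

Lemma nval_rcons U i v x : nval U i (rcons v x) = nval U i v + x * U (size v + i).
Proof. by rewrite -cats1 nval_cat nval_cons nval_nil addn0. Qed.

Lemma nval_mapD (S : Type) U i (f g : S -> nat) w :
  nval U i [seq f a + g a | a <- w] = nval U i (map f w) + nval U i (map g w).
Proof.
elim: w i => [|a w IH] i /=; first by rewrite !nval_nil.
by rewrite !nval_cons IH mulnDl addnACA.
Qed.

Lemma wval_diff (S : Type) U i (f g : S -> nat) w :
  wval U i [seq ((f a)%:Z - (g a)%:Z)%R | a <- w] =
  ((nval U i (map f w))%:Z - (nval U i (map g w))%:Z)%R.
Proof.
elim: w i => [|a w IH] i /=; first by rewrite !nval_nil /wval big_ord0.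
by rewrite wval_cons !nval_cons IH; lia.
Qed.

Lemma recog_nval_eq U (B : nat) : pisot_system U ->
  exists K, forall (S : Type) (z : S) (f g : S -> nat), f z = 0 -> g z = 0 ->
    (forall a, f a <= B) -> (forall a, g a <= B) ->
    recog z K (fun w => nval U 0 (map f w) = nval U 0 (map g w)).
Proof.
move=> pU; have [K hK] := recog_zero B pU; exists K => S z f g fz gz fB gB.
apply: recog_ext (hK S z (fun a => (f a)%:Z - (g a)%:Z)%R _ _).
- by move=> w; rewrite wval_diff; lia.
- by rewrite fz gz.
by move=> a; have := fB a; have := gB a; lia.
Qed.

(** * Greedy expansions *)

Lemma nval_greedy U m w : greedy_expansion U m w -> nval U 0 (rev w) = m.
Proof.
case=> -> _ _; rewrite /nval size_rev; apply: eq_bigr => j _.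
by rewrite addn0.
Qed.

Lemma greedy_digit U C m w x : (forall i, U i.+1 <= C * U i) ->
  greedy_expansion U m w -> x \in w -> x < C.
Proof.
move=> hC [_ gw _]; rewrite -mem_rev => /(nthP 0)[r]; rewrite size_rev => rw <-.
have := gw r rw; rewrite big_ord_recr /= => h.
have : digit w r * U r < C * U r by apply: leq_trans (hC r); lia.
by rewrite ltn_mul2r => /andP[].
Qed.

Lemma pisot_gt U : pisot_system U -> forall i, i < U i.
Proof.
case=> U0 Uinc _; elim=> [|i IH]; first by rewrite U0.
exact: leq_ltn_trans IH (Uinc i).
Qed.

(** Digits come from successive divisions by the U_i, from the top; taking as length the least k
    with m < U_k makes the leading digit non-zero. *)
Lemma greedy_exists U m : pisot_system U -> exists w, greedy_expansion U m w.
Proof.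
move=> pU; have gt := pisot_gt pU; have [U0 Uinc _] := pU.
have ex k m' : m' < U k -> exists v, [/\ size v = k, nval U 0 v = m' &
    forall r, r <= k -> nval U 0 (take r v) < U r].
  elim: k m' => [|k IH] m'.
    rewrite U0 ltnS leqn0 => /eqP->; exists [::]; split; rewrite ?nval_nil // => r _.
    by rewrite nval_nil; apply: leq_ltn_trans (gt r).
  move=> mk; have Uk : 0 < U k by apply: leq_ltn_trans (gt k).
  have [v [sv vv hv]] := IH (m' %% U k) (ltn_pmod _ Uk).
  have E : nval U 0 (rcons v (m' %/ U k)) = m'.
    by rewrite nval_rcons sv addn0 vv addnC -divn_eq.
  exists (rcons v (m' %/ U k)); split; rewrite ?size_rcons ?sv // => r.
  rewrite leq_eqVlt => /orP[/eqP->|rk].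
    by rewrite take_oversize ?size_rcons ?sv // E.
  by rewrite -cats1 takel_cat ?sv //; apply: hv.
pose k := ex_minn (ex_intro (fun k => m < U k) m (gt m)).
have [mk kmin] : m < U k /\ forall i, m < U i -> k <= i.
  by rewrite /k; case: ex_minnP.
have [v [sv vv hv]] := ex k m mk.
exists (rev v); rewrite /greedy_expansion /digit revK size_rev; split.
- by rewrite -vv; apply: eq_bigr => j _; rewrite addn0.
- move=> r rv; have := hv r.+1; rewrite -sv => /(_ rv).
  rewrite /nval size_takel //; congr (_ < _); apply: eq_bigr => j _.
  by rewrite nth_take // addn0.
case/lastP: v sv vv hv => [|v x] //; rewrite size_rcons nval_rcons rev_rcons /= => sk vv hv.
apply/eqP => x0; have : k <= size v.
  apply: kmin; rewrite -vv x0 mul0n addn0; have := hv (size v).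
  by rewrite -sk leqnSn -cats1 take_size_cat // => /(_ isT).
by rewrite -sk ltnn.
Qed.

Lemma rep_exists U n (x : position n) : pisot_system U -> exists w, rep U x w.
Proof.
move=> pU; have /choice[e he] : forall j : 'I_n, exists w, greedy_expansion U (tnth x j) w.
  by move=> j; apply: greedy_exists.
pose L := \max_(j < n) size (e j).
exists (mkseq (fun i => [tuple nth 0 (nseq (L - size (e j)) 0 ++ e j) i | j < n]) L).
exists e; split=> // [|j]; first by rewrite size_mkseq.
have s : size (nseq (L - size (e j)) 0 ++ e j) = L.
  by rewrite size_cat size_nseq subnK //; apply: (leq_bigmax j).
rewrite -map_comp -[RHS](mkseq_nth 0) s; apply: eq_map => i.
by rewrite /= tnth_mktuple.
Qed.

(* The state counts of the subset constructions for [bad_body] and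
   [escape_rel] below, for an automaton with s states; K ^ n states test
   equality of values. *)
Definition bad_states n K s := s.+2 * (s.+2 * K ^ n).
Definition escape_states n K s :=
  2 ^ (s.+2 * K ^ n) * 2 ^ (s.+2 * (2 ^ (K ^ n) * 2 ^ bad_states n K s)).
Definition value_bound (U : nat -> nat) c l := c * \sum_(i < l) U i.
(** One summand for the length of q, one for the word of p, bounded by the values of q, and one for
    the overhang of r and t. *)
Definition length_bound U n c K s :=
  escape_states n K s + value_bound U c (escape_states n K s) + bad_states n K s.

(** * From the given automaton to one for the counterexamples *)

Section Automaton.
Variables (U : nat -> nat) (pU : pisot_system U) (n : nat) (n0 : 0 < n).
Variables (c : nat) (hc : forall i, U i.+1 <= c * U i).
Variables (A : dfa n) (P : set (position n)) (AP : recognizes U A P).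

Let D := digits A.
Implicit Types (u : seq (n.-tuple 'I_D)) (j : 'I_n).

Definition track u j : seq nat := rev [seq nat_of_ord (tnth a j) | a <- u].

Definition member (x : 'I_n -> nat) : Prop :=
  exists2 u, accepts (A := A) u & forall j, nval U 0 (track u j) = x j.

Lemma letter_val_track u j :
  [seq tnth a j | a <- map (@letter_val n D) u] = rev (track u j).
Proof. by rewrite /track revK -map_comp; apply: eq_map => a; rewrite /= tnth_mktuple. Qed.

Lemma nval_rev_pad k w : nval U 0 (rev (nseq k 0 ++ w)) = nval U 0 (rev w).
Proof. by rewrite rev_cat rev_nseq nval_pad. Qed.

Lemma accepts_rep u : accepts (A := A) u ->
  exists2 x, P x & rep U x (map (@letter_val n D) u).
Proof.
move=> au; have : [set [seq letter_val a | a <- w] | w in [set w | accepts (A :=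
  A) w]]%classic (map (@letter_val n D) u) by exists u.
by rewrite -AP.
Qed.

Lemma memberP (x : position n) : P x <-> member (tnth x).
Proof.
split=> [Px|[u au ux]].
  have [v xv] := rep_exists x pU.
  have : [set v | exists2 x, P x & rep U x v]%classic v by exists x.
  rewrite AP => -[u au uv]; exists u => // j.
  have [e [ge _ ve]] := xv; rewrite -(nval_greedy (ge j)).
  by rewrite -[track u j]revK -letter_val_track uv ve nval_rev_pad.
have [y Py [e [ge _ ve]]] := accepts_rep au.
suff -> : x = y by [].
apply: position_eq => j; rewrite -ux -(nval_greedy (ge j)).
by rewrite -[track u j]revK -letter_val_track ve nval_rev_pad.
Qed.

(** This permits one fixed alphabet whatever [digits A] is. *)
Lemma accepts_digit u a j : accepts (A := A) u -> a \in u -> tnth a j <= c.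
Proof.
move=> au ua; have [y Py [e [ge _ ve]]] := accepts_rep au.
have : nat_of_ord (tnth a j) \in nseq ((\max_(j < n) size (e j)) - size (e j)) 0 ++ e j.
  by rewrite -ve letter_val_track revK; apply: map_f.
rewrite mem_cat mem_nseq => /orP[/andP[_ /eqP->]//|h].
by apply: ltnW; apply: greedy_digit hc (ge j) h.
Qed.

(** A component of maximal length gets no padding, so it shows its non-zero leading digit. *)
Lemma accepts_head u : accepts (A := A) u -> u != [::] ->
  exists j, head 0 (rev (track u j)) != 0.
Proof.
move=> au u0; have [y Py [e [ge sw ve]]] := accepts_rep au.
have [|j Ej] := @eq_bigmax _ (fun j => size (e j)); first by rewrite card_ord.
exists j; rewrite -letter_val_track ve Ej subnn /=.
have : size (e j) != 0 by rewrite -Ej -sw size_map size_eq0.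
by case: (ge j) => _ _; case: (e j).
Qed.

(** The non-zero leading digit at index i has weight U_i > i. *)
Lemma accepts_size u : accepts (A := A) u ->
  exists j, size u <= nval U 0 (track u j).
Proof.
move=> au; have [->|u0] := eqVneq u [::]; first by exists (Ordinal n0).
have [j hj] := accepts_head au u0; exists j.
have : size u = size (track u j) by rewrite size_rev size_map.
case/lastP: (track u j) hj => [|v x] //.
rewrite rev_rcons /= size_rcons nval_rcons addn0 => x0 ->.
have := pisot_gt pU (size v); case: x x0 => // x _; rewrite mulSn; lia.
Qed.

Local Notation letter := {ffun 'I_n -> 'I_c.+1}.
Definition letter0 : letter := [ffun=> ord0].
Implicit Types (w : seq letter).

Definition lval w j := nval U 0 [seq nat_of_ord ((a : letter) j) | a <- w].

Lemma lval_pad w k j : lval (w ++ nseq k letter0) j = lval w j.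
Proof. by rewrite /lval map_cat map_nseq ffunE nval_pad. Qed.

(* The automaton A, fed with digits up to c and allowed to skip leading zero
   letters; [None] is a sink and [Some None] the state in which only zeros have
   been read. *)
Definition narrow (a : letter) : option (n.-tuple 'I_D) :=
  [pick t : n.-tuple 'I_D | [forall j, tnth t j == a j :> nat]].
Definition padded_delta (q : 'I_(states A)) (a : letter) : option (option 'I_(states A)) :=
  if narrow a is Some t then Some (Some (delta q t)) else None.
Definition padded_step (a : letter) (o : option (option 'I_(states A))) :=
  match o with
  | None => None
  | Some None => if a == letter0 then Some None else padded_delta (start A) a
  | Some (Some q) => padded_delta q a
  end.
Definition padded_run w := foldr padded_step (Some None) w.
Definition padded_accepts w :=
  if padded_run w is Some o then final (odflt (start A) o) else false.

Lemma recog_padded_accepts : recog letter0 (states A).+2 (fun w => padded_accepts w).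
Proof.
exists (option (option 'I_(states A)) : finType), (Some None), padded_step.
exists (fun s => if s is Some o then final (odflt (start A) o) else false); split=> //.
  by rewrite !card_option card_ord.
by rewrite /= eqxx.
Qed.

Lemma narrowP a t : narrow a = Some t -> forall j, nat_of_ord (tnth t j) = a j.
Proof. by rewrite /narrow; case: pickP => // t' /forallP h [<-] j; apply/eqP. Qed.

(** The word u is the part of w fed to [A], and k counts the skipped leading zero letters. *)
Lemma padded_run_sound w o : padded_run w = Some o -> exists k u,
  [/\ size w = size u + k, (o = None -> u = [::]),
      foldl (@delta n A) (start A) u = odflt (start A) o &
      forall j, [seq nat_of_ord ((a : letter) j) | a <- w] = track u j ++ nseq k 0].
Proof.
elim: w o => [|a w IH] o /=; first by case=> <-; exists 0, [::].
case E : (padded_run w) => [o'|] //; have [k [u [sw uN fu tu]]] := IH _ E.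
have deltaP q o1 : foldl (@delta n A) (start A) u = q -> padded_delta q a = Some o1 ->
  exists k u,
  [/\ (size w).+1 = size u + k, (o1 = None -> u = [::]),
      foldl (@delta n A) (start A) u = odflt (start A) o1 &
      forall j, nat_of_ord (a j) :: [seq nat_of_ord ((a : letter) j) | a <- w] =
        track u j ++ nseq k 0].
  rewrite /padded_delta; case Et : (narrow a) => [t|] // fq [<-]; exists k, (rcons u t);
    split=> //.
  - by rewrite size_rcons sw.
  - by rewrite foldl_rcons fq.
  by move=> j; rewrite /track map_rcons rev_rcons /= (narrowP Et) tu.
case: o' E uN fu => [q|] E uN fu /=; first exact: deltaP.
case: eqP => [->|_]; last exact: deltaP.
case=> <-; exists k.+1, [::]; rewrite uN // in sw tu; split=> //.
  by rewrite sw.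
by move=> j; rewrite ffunE tu.
Qed.

Lemma padded_accepts_sound w : padded_accepts w -> exists u,
  [/\ accepts (A := A) u, size u <= size w & forall j, nval U 0 (track u j) = lval w j].
Proof.
rewrite /padded_accepts; case E : (padded_run w) => [o|] // fo.
have [k [u [sw _ fu tu]]] := padded_run_sound E; exists u; split.
- by rewrite /accepts fu.
- by rewrite sw leq_addr.
by move=> j; rewrite /lval tu nval_pad.
Qed.

Definition widen (t : n.-tuple 'I_D) : letter := [ffun j => inord (tnth t j)].

Lemma widenK (t : n.-tuple 'I_D) : (forall j, tnth t j <= c) -> narrow (widen t) = Some t.
Proof.
move=> tc; rewrite /narrow; case: pickP => [t' /forallP h|/(_ t)/negbT/forallPn[j]].
  congr Some; apply: eq_from_tnth => j; apply: val_inj; have /eqP := h j.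
  by rewrite /= ffunE inordK ?ltnS.
by rewrite ffunE inordK ?ltnS ?tc // eqxx.
Qed.

(** By [accepts_head] a non-empty accepted word starts with a non-zero letter, so the padded
    automaton skips nothing and follows [A] from its first letter on. *)
Lemma padded_accepts_complete u : accepts (A := A) u -> exists w,
  [/\ padded_accepts w, size w = size u & forall j, lval w j = nval U 0 (track u j)].
Proof.
move=> au; exists (rev (map widen u)).
have cu a j : a \in u -> tnth a j <= c by apply: accepts_digit.
split; last 1 first.
- move=> j; rewrite /lval /track map_rev -map_comp; congr (nval _ _ (rev _)).
  by apply/eq_in_map => a au' /=; rewrite ffunE inordK // ltnS cu.
- have hu : u != [::] -> exists j, head 0 (rev (track u j)) != 0 by apply: accepts_head.
  have -> : padded_accepts (rev (map widen u)) = final (foldl (@delta n A) (start A) u);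
    last exact: au.
  suff : padded_run (rev (map widen u)) =
      Some (if u is [::] then None else Some (foldl (@delta n A) (start A) u)).
    by rewrite /padded_accepts => ->; case: (u).
  rewrite /padded_run; move: {au} cu hu; elim/last_ind: u => [//|u t IH] cu hu.
  rewrite map_rcons rev_rcons /= IH; first last.
  - case: u {IH cu} hu => // a u hu _; have [//|j hj] := hu.
    by exists j; move: hj; rewrite /track !revK.
  - by move=> a j ain; apply: cu; rewrite mem_rcons inE ain orbT.
  have ct : narrow (widen t) = Some t.
    by apply: widenK => j; apply: cu; rewrite mem_rcons mem_head.
  case: u hu {IH cu} => [|a u] hu /=; last by rewrite /padded_delta ct foldl_rcons.
  rewrite /padded_delta ct; case: eqP => // E; have [//|j] := hu.
  rewrite /track revK /= => /negP[]; have /eqP := narrowP ct j.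
  by rewrite E ffunE.
by rewrite size_rev size_map.
Qed.

Lemma accepts_word u len : accepts (A := A) u -> size u <= len -> exists w,
  [/\ padded_accepts w, size w = len & forall j, lval w j = nval U 0 (track u j)].
Proof.
move=> au ul; have [w [pw sw vw]] := padded_accepts_complete au.
exists (w ++ nseq (len - size w) letter0); split.
- by apply/(recog_pad _ _ recog_padded_accepts).
- by rewrite size_cat size_nseq sw subnKC.
by move=> j; rewrite lval_pad.
Qed.

Lemma value_word (x : 'I_n -> nat) : exists w, forall j, lval w j = x j.
Proof.
have [v [e [ge sv ve]]] := rep_exists [tuple x j | j < n] pU.
exists (rev [seq [ffun j => inord (tnth t j)] | t : n.-tuple nat <- v]) => j.
rewrite -[x j](tnth_mktuple x) -(nval_greedy (ge j)) -(nval_rev_pad (\max_(j < n) size (e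
  j) - size (e j))).
rewrite -ve /lval map_rev -map_comp; congr (nval _ _ (rev _)); apply/eq_in_map => t tv /=.
rewrite ffunE inordK // ltnS.
have : tnth t j \in nseq ((\max_(j < n) size (e j)) - size (e j)) 0 ++ e j.
  by rewrite -ve; apply: map_f.
rewrite mem_cat mem_nseq => /orP[/andP[_ /eqP->]//|h].
by apply: ltnW; apply: greedy_digit hc (ge j) h.
Qed.

Lemma map_zip1 (S X Y : Type) (f : S -> Y) (a : seq S) (b : seq X) :
  size b = size a -> [seq f p.1 | p <- zip a b] = map f a.
Proof. by move=> s; rewrite (map_comp f fst) -/(unzip1 _) unzip1_zip // s. Qed.

Lemma map_zip2 (S X Y : Type) (f : X -> Y) (a : seq S) (b : seq X) :
  size b = size a -> [seq f p.2 | p <- zip a b] = map f b.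
Proof. by move=> s; rewrite (map_comp f snd) -/(unzip2 _) unzip2_zip // s. Qed.

(** The digit bound is [c.*2] because sums of two digits occur as digits. *)
Variables (K : nat) (hK : forall (S : Type) (z : S) (f g : S -> nat), f z = 0 -> g z = 0 ->
    (forall a, f a <= c.*2) -> (forall a, g a <= c.*2) ->
    recog z K (fun v => nval U 0 (map f v) = nval U 0 (map g v))).

Local Notation dg a j := (nat_of_ord ((a : letter) j)).

Lemma dg_le (a : letter) j : dg a j <= c. Proof. by rewrite -ltnS. Qed.

(** The word for q need not be greedy, so membership of its value asks for an accepted word of equal
    value rather than for its own acceptance. *)
Definition member_body (w : seq (letter * letter)) : Prop :=
  padded_accepts (map snd w) /\
  forall j, nval U 0 [seq dg a.1 j | a <- w] = nval U 0 [seq dg a.2 j | a <- w].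
(** The tracks are q, p and their difference, so that comparison too reduces to equality of
    values. *)
Definition ge_body (w : seq ((letter * letter) * letter)) : Prop :=
  forall j, nval U 0 [seq dg a.1.1 j | a <- w] =
    nval U 0 [seq dg a.1.2 j + dg a.2 j | a <- w].
(** The tracks are ((q, p), (r, t)), in the notation of [bad_pair]. *)
Definition bad_body (w : seq ((letter * letter) * (letter * letter))) : Prop :=
  padded_accepts [seq a.2.1 | a <- w] /\ (padded_accepts [seq a.2.2 | a <- w] /\
  forall j, nval U 0 [seq dg a.2.2 j + dg a.1.2 j | a <- w] =
            nval U 0 [seq dg a.2.1 j + dg a.1.1 j | a <- w]).
Definition member_rel w := exists k, extend letter0 member_body k w.
Definition ge_rel (w : seq (letter * letter)) :=
  exists k, extend (letter0, letter0) ge_body k w.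
Definition bad_rel (w : seq (letter * letter)) :=
  exists k, extend (letter0, letter0) bad_body k w.
Definition absorbed_body (w : seq (letter * letter)) : Prop :=
  padded_accepts (map snd w) /\ (ge_rel w /\ ~ bad_rel w).
Definition absorbed_rel w := exists k, extend letter0 absorbed_body k w.
Definition escape_rel w := ~ member_rel w /\ ~ absorbed_rel w.

Local Notation s := (states A).+2.
Local Notation bad_size := (bad_states n K (states A)).
Local Notation escape_size := (escape_states n K (states A)).

Lemma recog_bad_body : recog ((letter0, letter0), (letter0, letter0)) bad_size bad_body.
Proof.
apply: recog_and.
  exact: (recog_map (h := fun a : (letter * letter) * (letter * letter) => a.2.1) _
    recog_padded_accepts).
apply: recog_and.
  exact: (recog_map (h := fun a : (letter * letter) * (letter * letter) => a.2.2) _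
    recog_padded_accepts).
apply: recog_forall => j; apply: hK; rewrite /= ?ffunE // => a;
  rewrite -addnn leq_add ?dg_le //.
Qed.

Lemma recog_escape_rel : recog letter0 escape_size escape_rel.
Proof.
have acc2 : recog (letter0, letter0) s (fun v => padded_accepts (map snd v)).
  exact: (recog_map (h := @snd letter letter) _ recog_padded_accepts).
apply: recog_and; apply: recog_not; apply: (recog_ex (zx := letter0)).
  apply: recog_and acc2 _.
  by apply: recog_forall => j; apply: hK; rewrite /= ?ffunE // => a;
    apply: leq_trans (dg_le _ _) _; rewrite -addnn leq_addr.
apply: recog_and acc2 _; apply: recog_and.
  apply: (recog_ex (zx := letter0)); apply: recog_forall => j; apply: hK;
    rewrite /= ?ffunE // => a.
    by apply: leq_trans (dg_le _ _) _; rewrite -addnn leq_addr.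
  by rewrite -addnn leq_add ?dg_le.
by apply: recog_not; apply: (recog_ex (zx := (letter0, letter0))); exact: recog_bad_body.
Qed.

Lemma size_pad (S : Type) (z : S) (v : seq S) k : size (v ++ nseq k z) = size v + k.
Proof. by rewrite size_cat size_nseq. Qed.

Lemma member_relP w : member_rel w <-> member (lval w).
Proof.
split.
  move=> [k [x sx [px vx]]].
  have sx' : size x = size (w ++ nseq k letter0) by rewrite size_pad.
  rewrite (map_zip2 id) // map_id in px; have [u [au _ uv]] := padded_accepts_sound px.
  exists u => // j; rewrite uv; have := vx j.
  rewrite (map_zip1 (fun a : letter => dg a j)) // (map_zip2 (fun a : letter => dg a j)) //.
  by rewrite -!/(lval _ j) lval_pad.
move=> [u au uv]; have [|x [px sx vx]] := accepts_word (len := size w + size u) au;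
  first exact: leq_addl.
exists (size u), x => //; have sx' : size x =
  size (w ++ nseq (size u) letter0) by rewrite size_pad.
split=> [|j]; first by rewrite (map_zip2 id) // map_id.
rewrite (map_zip1 (fun a : letter => dg a j)) // (map_zip2 (fun a : letter => dg a j)) //.
by rewrite -!/(lval _ j) lval_pad vx uv.
Qed.

Lemma word_pad w len : size w <= len -> exists w',
  size w' = len /\ forall j, lval w' j = lval w j.
Proof.
move=> wl; exists (w ++ nseq (len - size w) letter0); rewrite size_pad subnKC //;
  split=> // j.
exact: lval_pad.
Qed.

Lemma nseq_pair (S X : Type) k (a : S) (b : X) : nseq k (a, b) = zip (nseq k a) (nseq k b).
Proof. by elim: k => //= k ->. Qed.

Lemma zip_pad q p k : size p = size q ->
  zip q p ++ nseq k (letter0, letter0) = zip (q ++ nseq k letter0) (p ++ nseq k letter0).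
Proof. by move=> sp; rewrite nseq_pair zip_cat. Qed.

Lemma ge_relP q p : size p = size q -> ge_rel (zip q p) <-> forall j, lval p j <= lval q j.
Proof.
move=> sp.
have E k x j : size x = size q + k ->
  nval U 0 [seq dg a.1.1 j | a <- zip (zip q p ++ nseq k (letter0, letter0)) x] =
    lval q j /\
  nval U 0 [seq dg a.1.2 j + dg a.2 j | a <- zip (zip q p ++ nseq k (letter0, letter0)) x] =
    lval p j + lval x j.
  move=> sx; have sx' : size x = size (zip q p ++ nseq k (letter0, letter0)).
    by rewrite size_pad size_zip sp minnn.
  rewrite nval_mapD (map_zip1 (fun a : letter * letter => dg a.1 j)) //.
  rewrite (map_zip1 (fun a : letter * letter => dg a.2 j)) //
    (map_zip2 (fun a : letter => dg a j)) //.
  rewrite zip_pad // (map_zip1 (fun a : letter => dg a j)) ?size_pad ?sp //.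
  by rewrite (map_zip2 (fun a : letter => dg a j)) ?size_pad ?sp // -!/(lval _ j) !lval_pad.
split.
  move=> [k [x sx h]] j; rewrite size_zip sp minnn in sx.
  by have := h j; have [-> ->] := E k x j sx; lia.
move=> h; have [x vx] := value_word (fun j => lval q j - lval p j).
have [|x' [sx' vx']] := word_pad (len := size q + size x) (w := x); first exact: leq_addl.
exists (size x), x'; first by rewrite size_zip sp minnn.
move=> j; have [-> ->] := E (size x) x' j sx'; rewrite vx' vx subnKC //.
Qed.

(** * Length bounds for the witnesses *)

Definition bad (M : ('I_n -> nat) -> Prop) (q p : 'I_n -> nat) :=
  exists r t, [/\ M r, M t & forall j, t j + p j = r j + q j].

Definition member_le (L : nat) (x : 'I_n -> nat) : Prop :=
  exists2 u, accepts (A := A) u & size u <= L /\ forall j, nval U 0 (track u j) = x j.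

Lemma bad_bodyP q p k r t : size p = size q -> size r = size q + k -> size t = size q + k ->
  bad_body (zip (zip q p ++ nseq k (letter0, letter0)) (zip r t)) <->
  [/\ padded_accepts r, padded_accepts t & forall j, lval t j + lval p j =
    lval r j + lval q j].
Proof.
move=> sp sr st.
have srt : size t = size r by rewrite st sr.
have sx' : size (zip r t) = size (zip q p ++ nseq k (letter0, letter0)).
  by rewrite size_pad !size_zip sp minnn st sr minnn.
have E j : nval U 0 [seq dg a.2.2 j + dg a.1.2 j | a <- zip (zip q p ++ nseq k (letter0,
  letter0)) (zip r t)] =
   lval t j + lval p j /\
   nval U 0 [seq dg a.2.1 j + dg a.1.1 j | a <- zip (zip q p ++ nseq k (letter0, letter0))
     (zip r t)] =
   lval r j + lval q j.
  rewrite !nval_mapD (map_zip1 (fun a : letter * letter => dg a.1 j)) //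
    (map_zip1 (fun a : letter * letter => dg a.2 j)) //.
  rewrite (map_zip2 (fun a : letter * letter => dg a.1 j)) //
    (map_zip2 (fun a : letter * letter => dg a.2 j)) //.
  rewrite zip_pad // !(map_zip1 (fun a : letter => dg a j)) ?size_pad ?sp //.
  by rewrite !(map_zip2 (fun a : letter => dg a j)) ?size_pad ?sp //
    -!/(lval _ j) !lval_pad.
rewrite /bad_body (map_zip2 (@fst letter letter)) // (map_zip2 (@snd letter letter)) //.
rewrite -/(unzip1 _) -/(unzip2 _) unzip1_zip ?srt // unzip2_zip ?srt //.
by split=> [[-> [-> h]]|[-> -> h]]; do !split=> //; move=> j; have := h j; have [-> ->] :=
  E j.
Qed.

(** Pumping cuts the overhang of r and t below [bad_size], and passing back to words of [A] removes
    at most leading zeros. *)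
Lemma bad_rel_bounded q p : size p = size q -> bad_rel (zip q p) ->
  bad (member_le (size q + bad_size)) (lval q) (lval p).
Proof.
move=> sp [k0 /(recog_extend_short recog_bad_body)[k kN [x sx h]]].
rewrite size_zip sp minnn in sx.
have Ex : x = zip (unzip1 x) (unzip2 x) by rewrite zip_unzip.
rewrite Ex in h; have /bad_bodyP[]// := h; rewrite ?size_map //.
move=> pr pt vE; have [r [ar sr vr]] := padded_accepts_sound pr; have [t [at_ st vt]] :=
  padded_accepts_sound pt.
rewrite !size_map sx in sr st.
exists (lval (unzip1 x)), (lval (unzip2 x)); split=> //.
  by exists r => //; split=> //; apply: leq_trans sr _; rewrite leq_add2l ltnW.
by exists t => //; split=> //; apply: leq_trans st _; rewrite leq_add2l ltnW.
Qed.

Lemma bad_bad_rel q p : size p = size q -> bad member (lval q) (lval p) ->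
  bad_rel (zip q p).
Proof.
move=> sp [r [t [[ur ar vr] [ut at_ vt] h]]].
pose k := size ur + size ut.
have [|r' [pr sr vr']] := accepts_word (len := size q + k) ar;
  first by rewrite /k addnCA leq_addr.
have [|t' [pt st vt']] := accepts_word (len := size q + k) at_;
  first by rewrite /k addnA leq_addl.
exists k, (zip r' t'); first by rewrite !size_zip sp sr st !minnn.
by apply/bad_bodyP => //; split=> // j; rewrite vr' vr vt' vt h.
Qed.

Definition absorbs (M : ('I_n -> nat) -> Prop) (q : 'I_n -> nat) :=
  M q \/ exists p, [/\ M p, forall j, p j <= q j & ~ bad M q p].

Lemma member_le_member L x : member_le L x -> member x.
Proof. by move=> [u au [_ ux]]; exists u. Qed.

Lemma bad_sub (M M' : ('I_n -> nat) -> Prop) q p :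
  (forall x, M x -> M' x) -> bad M q p -> bad M' q p.
Proof. by move=> MM' [r [t [/MM' Mr /MM' Mt h]]]; exists r, t. Qed.

Lemma not_absorbs_escape q : ~ absorbs member (lval q) -> escape_rel q.
Proof.
move=> nq; split=> [/member_relP|]; first by move=> mq; apply: nq; left.
move=> [k [p sp [pp [r2 r3]]]].
have sp' : size p = size (q ++ nseq k letter0) by rewrite size_pad.
rewrite (map_zip2 id) // map_id in pp; have [u [au _ uv]] := padded_accepts_sound pp.
move: r2 => /(ge_relP sp') r2.
apply: nq; right; exists (lval p); split.
- by exists u.
- by move=> j; rewrite -(lval_pad q k).
move=> b; apply/r3/bad_bad_rel => //; move: b; rewrite /bad => -[r [t [mr mt h]]].
by exists r, t; split=> // j; rewrite lval_pad.
Qed.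

Lemma member_le_of_le x q L : member x -> (forall j, x j <= q j) -> (forall j, q j <= L) ->
  member_le L x.
Proof.
move=> [u au ux] xq qL; exists u => //; split=> //.
have [j /leq_trans-> //] := accepts_size au.
by rewrite ux; apply: leq_trans (xq j) (qL j).
Qed.

(** As M also occurs negatively in [absorbs], monotonicity does not suffice: p is bounded through V,
    and a bad pair for this p must then have short witnesses. *)
Lemma escape_not_absorbs_le q V L : (forall j, lval q j <= V) ->
  size q + V + bad_size <= L ->
  escape_rel q -> ~ absorbs (member_le L) (lval q).
Proof.
move=> qV qL [n1 n4] [/member_le_member/member_relP//|[p [mp pq nb]]].
have [u au [ul uv]] := member_le_of_le (member_le_member mp) pq qV.
(* Padding q by V zero letters makes room for the word of p, of length at most V. *)
apply: n4; exists V.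
have [|w [pw sw vw]] := accepts_word (len := size q + V) au;
  first exact: leq_trans ul (leq_addl _ _).
exists w => //; have sw' : size w = size (q ++ nseq V letter0) by rewrite size_pad.
split; first by rewrite (map_zip2 id) // map_id.
split; first by apply/ge_relP => // j; rewrite lval_pad vw uv.
move=> /(bad_rel_bounded sw')[r [t [mr mt h]]]; apply: nb; exists r, t.
have sub x : member_le (size (q ++ nseq V letter0) + bad_size) x -> member_le L x.
  by move=> [ux ax [sx vx]]; exists ux => //; split=> //; apply: leq_trans sx _;
    rewrite size_pad.
split; [exact: sub | exact: sub | move=> j].
by have := h j; rewrite lval_pad vw uv.
Qed.

Local Notation vbound := (value_bound U c escape_size).
Local Notation lbound := (length_bound U n c K (states A)).

Lemma lval_vbound w j : size w = escape_size -> lval w j <= vbound.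
Proof.
move=> sw; rewrite /lval /nval /value_bound size_map sw big_distrr /=.
apply: leq_sum => i _; rewrite addn0 leq_mul2r (nth_map letter0) ?sw //.
by rewrite dg_le orbT.
Qed.

(** From left to right, the value of q bounds the word of p. From right to left, a counterexample of
    any size yields a short one by pumping. *)
Lemma absorbing_bounded : absorbing P <->
  forall w, size w = escape_size -> absorbs (member_le lbound) (lval w).
Proof.
have memE (x : 'I_n -> nat) : P [tuple x j | j < n] <-> member x.
  rewrite memberP; suff -> : tnth [tuple x j | j < n] = x by [].
  by apply: funext => j; rewrite tnth_mktuple.
have -> : absorbing P <-> forall x, absorbs member x.
  split=> h.
    move=> x; have [|nm] := pselect (member x); first by left.
    right; have [|p [Pp pq nb]] := h [tuple x j | j < n]; first by rewrite memE.
    exists (tnth p); split; first exact/memberP.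
      by move=> j; have := pq j; rewrite tnth_mktuple.
    move=> [r [t [mr mt e]]]; apply: nb; exists [tuple r j | j < n], [tuple t j | j < n].
    by split; [exact/memE | exact/memE | move=> j; rewrite !tnth_mktuple].
  move=> q nq; have [/memberP//|[p [mp pq nb]]] := h (tnth q).
  exists [tuple p j | j < n]; split; first exact/memE.
    by move=> j; rewrite tnth_mktuple.
  move=> [r [t [Pr Pt e]]]; apply: nb; exists (tnth r), (tnth t).
  split; [exact/memberP | exact/memberP | move=> j].
  by have := e j; rewrite tnth_mktuple.
split=> h.
  move=> w sw; have V j : lval w j <= lbound.
    by apply: leq_trans (lval_vbound j sw) _; rewrite /length_bound; lia.
  have [mw|[p [mp pq nb]]] := h (lval w).
    by left; apply: member_le_of_le mw _ V.
  right; exists p; split=> //; first exact: member_le_of_le mp pq V.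
  by move=> b; apply: nb; apply: bad_sub b; apply: member_le_member.
move=> x; apply: contrapT => nx.
have [w vw] := value_word x.
have rw : escape_rel w.
  by apply: not_absorbs_escape; rewrite (_ : lval w = x) //; apply: funext.
have [w' sw' rw'] := recog_short recog_escape_rel (ex_intro _ w rw).
(* Padding to the exact length leaves a single length to search. *)
pose v := w' ++ nseq (escape_size - size w') letter0.
have sv : size v = escape_size by rewrite size_pad subnKC // ltnW.
have rv : escape_rel v by apply/(recog_pad _ _ recog_escape_rel).
apply: (escape_not_absorbs_le (q := v) (V := vbound) (L := lbound)) (h v sv) => //.
  by move=> j; apply: lval_vbound.
by rewrite sv.
Qed.

End Automaton.

(** * The decision procedure *)

Lemma computable_code m (gs : seq ((nat -> nat) -> nat)) :
  foldr (fun g P => computable m g /\ P) True gs ->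
  computable m (fun e => CodeSeq.code [seq g e | g <- gs]).
Proof.
elim: gs => [_|g gs IH /= [hg /IH hgs]]; first exact: computable_cst.
apply: (@computable_ext _ (fun e => 2 ^ g e * (CodeSeq.code [seq g e | g <- gs] +
    CodeSeq.code [seq g e | g <- gs]).+1)).
  by move=> e; rewrite addnn.
apply: computable_mul; first by apply: computable_exp => //; apply: computable_cst.
by apply: computable_succ; apply: computable_add.
Qed.

(** Finitely many values of p occur and enter as constants, so p itself may be any function. *)
Lemma computable_lincomb m (p : nat -> nat) (f : (nat -> nat) -> nat) (js : seq nat) :
  computable m f -> computable m (fun e => \sum_(j <- js) p j * code_nth (f e) j).
Proof.
move=> hf; elim: js => [|j js IH].
  apply: (@computable_ext _ (fun=> 0)); last exact: computable_cst.
  by move=> e; rewrite big_nil.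
apply: (@computable_ext _ (fun e => p j * code_nth (f e) j + \sum_(j <- js) p j * code_nth
  (f e) j)).
  by move=> e; rewrite big_cons.
apply: computable_add => //; apply: computable_mul; first exact: computable_cst.
by apply: computable_code_nth => //; apply: computable_cst.
Qed.

(* The recursion runs on the code of the window U_i, ..., U_(i+d). *)
Lemma computable_recurrence (U : nat -> nat) d (a : nat -> int) m f :
  (forall i, (U (i + d.+1)%N)%:Z = \sum_(j < d.+1) a j * (U (i + j)%N)%:Z)%R ->
  computable m f -> computable m (fun e => U (f e)).
Proof.
move=> hU; apply: computable_fun1.
(* Recursive functions handle natural numbers, so the coefficients are split by sign; on windows of
   U the truncated difference is exact because its result is a term of U. *)
pose pos j := if (0 <= a j)%R then absz (a j) else 0.
pose neg j := if (0 <= a j)%R then 0 else absz (a j).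
pose lc (p : nat -> nat) y := \sum_(j <- iota 0 d.+1) p j * code_nth y j.
pose step y := CodeSeq.code (rcons [seq code_nth y i.+1 | i <- iota 0 d] (lc pos y - lc
  neg y)).
pose win i := CodeSeq.code [seq U (i + j) | j <- iota 0 d.+1].
have nth_win i j : j <= d -> code_nth (win i) j = U (i + j).
  by move=> jd; rewrite code_nthE (nth_map 0) ?size_iota // nth_iota.
have lcE p i : lc p (win i) = \sum_(j < d.+1) p j * U (i + j).
  rewrite -(big_mkord xpredT (fun j => p j * U (i + j))) /lc /index_iota subn0.
  by apply: eq_big_seq => j; rewrite mem_iota add0n ltnS => /andP[_ jd]; rewrite nth_win.
have sumE (i : nat) : (\sum_(j < d.+1) a j * (U (i + j)%N)%:Z =
    (\sum_(j < d.+1) pos j * U (i + j))%N%:Z - (\sum_(j < d.+1) neg j * U (i + j))%N%:Z)%R.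
  rewrite !(big_morph Posz PoszD (erefl _ : Posz 0 = 0%R)) -GRing.sumrB;
    apply: eq_bigr => j _.
  by rewrite /pos /neg; case: (a j) => k /=; rewrite mul0n; lia.
have stepE i : step (win i) = win i.+1.
  rewrite /step -[RHS]/(CodeSeq.code [seq U (i.+1 + j) | j <- iota 0 d.+1]).
  congr CodeSeq.code.
  rewrite -[d.+1]addn1 iotaD map_cat /= cats1.
  congr rcons.
    by apply/eq_in_map => j; rewrite mem_iota add0n => /andP[_ jd]; rewrite nth_win //
      addSnnS.
  by rewrite !lcE add0n addSnnS; have := hU i; rewrite sumE; lia.
have winE i : win i = nrec (win 0) (fun _ y => step y) i.
  by elim: i => //= i <-; rewrite stepE.
apply: (@computable_ext _ (fun e => code_nth (nrec (win 0) (fun _ y => step y) (e 0)) 0)).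
  by move=> e; rewrite -winE nth_win // addn0.
apply: computable_code_nth; last exact: computable_cst.
apply: (@computable_nrec 1 _ _ (fun _ y _ => step y));
  [exact: computable_cst | exact: computable_var |].
apply: (@computable_ext _ (fun e => CodeSeq.code [seq g e | g <-
    rcons [seq (fun e : nat -> nat => code_nth (e 1) i.+1) | i <- iota 0 d]
      (fun e => lc pos (e 1) - lc neg (e 1))])).
  by move=> e; rewrite map_rcons -map_comp.
apply: computable_code; elim: (iota 0 d) => [|i js IH] /=; split=> //.
  by apply: computable_sub; apply: computable_lincomb; apply: computable_var.
by apply: computable_code_nth; [exact: computable_var | exact: computable_cst].
Qed.

Lemma pisot_computable U m f : pisot_system U ->
  computable m f -> computable m (fun e => U (f e)).
Proof. by move=> /pisot_recurrence[d [a hU]]; apply: computable_recurrence hU. Qed.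

(** * Coding words over the alphabet by numbers *)

Lemma nth_allpairs (S T R : Type) (f : S -> T -> R) s t x0 y0 r0 i k :
  i < size s -> k < size t ->
  nth r0 [seq f x y | x <- s, y <- t] (i * size t + k) = f (nth x0 s i) (nth y0 t k).
Proof.
elim: s i => [|x s IH] [|i] //= si kt; rewrite nth_cat size_map.
  by rewrite kt (nth_map y0).
by rewrite mulSn -addnA ltnNge leq_addr /= addKn IH.
Qed.

(* The j-th digit of the i-th letter in the lexicographic enumeration
   [letters n D]. *)
Definition dig n D i j := (i %/ D ^ (n.-1 - j)) %% D.

Lemma size_letters n D : size (letters n D) = D ^ n.
Proof. by elim: n => //= n IH; rewrite size_allpairs size_enum_ord IH expnS. Qed.

Lemma mem_letters n D (t : n.-tuple 'I_D) : t \in letters n D.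
Proof.
elim: n t => [|n IH] t; first by rewrite tuple0 inE.
case/tupleP: t => x t; apply/allpairsP; exists (x, t).
by rewrite mem_enum IH.
Qed.

Lemma uniq_letters n D : uniq (letters n D).
Proof.
elim: n => //= n IH; apply: allpairs_uniq => //; first exact: enum_uniq.
move=> [x t] [y u] _ _ /= /(congr1 val) /= [-> E].
by congr pair; apply: val_inj.
Qed.

Lemma tnth_letters n D (t : n.-tuple 'I_D) (j : 'I_n) i :
  i < D ^ n -> nat_of_ord (tnth (nth t (letters n D) i) j) = dig n D i j.
Proof.
elim: n t i j => [|n IH] t i j; first by case: j.
case/tupleP: t => x t iD; have D0 : 0 < D by case: (D) x => // -[].
have Dn0 : 0 < D ^ n by rewrite expn_gt0 D0.
have i1 : i %/ D ^ n < D by rewrite ltn_divLR // -expnS.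
have i2 : i %% D ^ n < D ^ n by rewrite ltn_pmod.
rewrite {1}(divn_eq i (D ^ n)) -{2}(size_letters n D) (nth_allpairs _ x t) ?size_letters
  ?size_enum_ord //.
rewrite /dig; case: (unliftP ord0 j) => [k ->|->].
  rewrite tnthS IH // /dig /= /bump /= add1n.
  have -> : n - k.+1 = n.-1 - k by lia.
  rewrite !modn_divl modn_dvdm // -expnS; apply: dvdn_exp2l.
  by have := ltn_ord k; lia.
by rewrite tnth0 nth_enum_ord //= subn0 modn_small.
Qed.

Lemma tnth_index n D (t : n.-tuple 'I_D) (j : 'I_n) :
  nat_of_ord (tnth t j) = dig n D (index t (letters n D)) j.
Proof.
rewrite -(@tnth_letters _ _ t) ?nth_index ?mem_letters //.
by rewrite -size_letters index_mem mem_letters.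
Qed.

Definition idx b w k := (w %/ b ^ k) %% b.

Lemma idx_word b (s : seq nat) : all (fun i => i < b) s ->
  exists2 w, w < b ^ size s & mkseq (idx b w) (size s) = s.
Proof.
elim: s => [_|x s IH /= /andP[xb /IH[w wb ws]]]; first by exists 0.
have b0 : 0 < b by apply: leq_ltn_trans xb.
exists (x + w * b).
  rewrite expnS; have : w.+1 * b <= b ^ size s * b by rewrite leq_mul2r wb orbT.
  by lia.
rewrite /mkseq -[(size s).+1]add1n iotaD map_cat /=; congr cons.
  by rewrite /idx expn0 divn1 addnC modnMDl modn_small.
rewrite -[RHS]ws /mkseq -[X in iota X _]/(1 + 0) iotaDl -map_comp; apply: eq_map => k /=.
by rewrite /idx add1n expnS divnMA addnC divnMDl // (divn_small xb) addn0.
Qed.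

(** Digit k of w in base [D ^ n] numbers the letter of weight U_k, hence [rev]; a quantifier over
    words of length l becomes one bounded by [(D ^ n) ^ l]. *)
Definition codes n D (u : seq (n.-tuple 'I_D)) l w :=
  [seq index a (letters n D) | a <- rev u] = mkseq (idx (D ^ n) w) l.

Lemma codes_exist n D (u : seq (n.-tuple 'I_D)) :
  exists2 w, w < (D ^ n) ^ size u & codes u (size u) w.
Proof.
have [|w] := @idx_word (D ^ n) [seq index a (letters n D) | a <- rev u].
  by apply/allP => _ /mapP[a _ ->]; rewrite -size_letters index_mem mem_letters.
by rewrite size_map size_rev => wu wE; exists w.
Qed.

Lemma codes_decode n D l w : w < (D ^ n) ^ l -> exists2 u : seq (n.-tuple 'I_D),
  size u = l & codes u l w.
Proof.
case: l => [|l] wl; first by exists [::].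
have b0 : 0 < D ^ n by case: (D ^ n) wl => //; rewrite exp0n.
(* A code for a non-empty word forces the alphabet to be inhabited; t serves as the default of
   [nth]. *)
have [t _] : exists t : n.-tuple 'I_D, true.
  by move: b0; rewrite -size_letters; case: (letters n D) => // t; exists t.
exists (rev (mkseq (fun k => nth t (letters n D) (idx (D ^ n) w k)) l.+1)).
  by rewrite size_rev size_mkseq.
rewrite /codes revK -map_comp; apply: eq_map => k /=.
by rewrite index_uniq ?uniq_letters // size_letters ltn_pmod.
Qed.

Lemma codes_size n D (u : seq (n.-tuple 'I_D)) l w : codes u l w -> size u = l.
Proof. by move=> /(congr1 size); rewrite size_map size_rev size_mkseq. Qed.

Definition cval U n D l w j := nsum l (fun k => dig n D (idx (D ^ n) w k) j * U k).

Lemma codes_cval U n D (u : seq (n.-tuple 'I_D)) l w (j : 'I_n) : codes u l w ->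
  nval U 0 (rev [seq nat_of_ord (tnth a j) | a <- u]) = cval U n D l w j.
Proof.
move=> cu; rewrite -map_rev (eq_map (fun a => tnth_index a j)).
rewrite (map_comp (fun i => dig n D i j) (fun a => index a (letters n D))) cu -map_comp.
rewrite /nval size_map size_iota; apply: eq_bigr => k _.
by rewrite (nth_map 0) ?size_iota // nth_iota // addn0.
Qed.

(** Row y of the transition table starts at [y * D ^ n]. The automaton reads the most significant
    letter first, so step k uses digit [l - k.+1] of the code. *)
Definition crun n D q0 dels l w :=
  nrec q0 (fun k y => code_nth dels (y * D ^ n + idx (D ^ n) w (l - k.+1))) l.

Lemma eq_nrec a f g k : (forall i y, i < k -> f i y = g i y) -> nrec a f k = nrec a g k.
Proof.
elim: k => //= k IH fg; rewrite fg // IH // => i y ik.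
by apply: fg; apply: ltnW.
Qed.

Lemma foldl_nrec (f : nat -> nat -> nat) y s :
  foldl f y s = nrec y (fun k y => f y (nth 0 s k)) (size s).
Proof.
elim/last_ind: s => [//|s x IH]; rewrite foldl_rcons size_rcons /= nth_rcons ltnn eqxx IH.
by congr f; apply: eq_nrec => k y' ks; rewrite nth_rcons ks.
Qed.

Section Decide.
Variables (n : nat) (A : dfa n).
Let D := digits A.
Let dels := CodeSeq.code [seq nat_of_ord (delta q a)
                     | q <- enum 'I_(states A), a <- letters n (digits A)].
Let fins := CodeSeq.code [seq nat_of_bool (final q) | q <- enum 'I_(states A)].

Lemma dels_nth (q : 'I_(states A)) (a : n.-tuple 'I_D) :
  code_nth dels (q * D ^ n + index a (letters n D)) = delta q a.
Proof.
rewrite code_nthE -size_letters (nth_allpairs _ q a) ?size_enum_ord ?index_mem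
  ?mem_letters //.
by rewrite nth_ord_enum nth_index ?mem_letters.
Qed.

Lemma fins_nth (q : 'I_(states A)) : code_nth fins q = final q.
Proof. by rewrite code_nthE (nth_map q) ?size_enum_ord // nth_ord_enum. Qed.

Lemma codes_run (u : seq (n.-tuple 'I_D)) l w : codes u l w ->
  crun n D (start A) dels l w = foldl (@delta n A) (start A) u.
Proof.
move=> cu; have sl := codes_size cu.
transitivity (foldl (fun y i => code_nth dels (y * D ^ n + i)) (start A)
    [seq index a (letters n D) | a <- u]); last first.
  by elim/last_ind: u {cu sl} => // u a IH; rewrite map_rcons !foldl_rcons IH dels_nth.
rewrite foldl_nrec size_map sl /crun -[u]revK map_rev cu.
apply: eq_nrec => k y kl.
by rewrite nth_rev ?size_mkseq // nth_mkseq //; lia.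
Qed.

Lemma codes_accepts (u : seq (n.-tuple 'I_D)) l w : codes u l w ->
  (1 <= code_nth fins (crun n D (start A) dels l w)) = accepts (A := A) u.
Proof. by move=> cu; rewrite (codes_run cu) fins_nth /accepts; case: final. Qed.
End Decide.

Ltac comp_step := cbv beta; first
  [ apply: computable_var | apply: computable_cst
  | apply: computable_nsum | apply: computable_nrec
  | apply: dec_bex | apply: dec_ball
  | apply: dec_neg | apply: dec_and | apply: dec_or | apply: dec_leq | apply: dec_eq
  | apply: computable_succ | apply: computable_code_nth
  | apply: computable_add | apply: computable_sub
  | apply: computable_mul | apply: computable_exp
  | apply: computable_div | apply: computable_mod ].

(** * The bounded search and its correctness *)

Section Decision.
Variables (U : nat -> nat) (n c K : nat) (pU : pisot_system U).

Lemma computable_cval m D l w j : computable m D -> computable m l ->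
  computable m w -> computable m j ->
  computable m (fun e => cval U n (D e) (l e) (w e) (j e)).
Proof.
apply: computable_fun4; rewrite /cval /dig /idx.
by repeat comp_step; apply: pisot_computable pU _; repeat comp_step.
Qed.

Lemma computable_crun m D q0 dels l w : computable m D -> computable m q0 ->
  computable m dels -> computable m l -> computable m w ->
  computable m (fun e => crun n (D e) (q0 e) (dels e) (l e) (w e)).
Proof. by apply: computable_fun5; rewrite /crun /idx; repeat comp_step. Qed.

Lemma computable_escape_states m s : computable m s ->
  computable m (fun e => escape_states n K (s e)).
Proof. by apply: computable_fun1; rewrite /escape_states /bad_states; repeat comp_step. Qed.

Lemma computable_length_bound m s : computable m s ->
  computable m (fun e => length_bound U n c K (s e)).
Proof.
apply: computable_fun1; rewrite /length_bound /value_bound /bad_states.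
have h := computable_escape_states (computable_var 1 0).
repeat comp_step => //; apply: (computable_nsum (F := fun i _ => U i)) => //.
by apply: pisot_computable pU _; repeat comp_step.
Qed.

Section Formula.
Variables D s q0 fins dels : nat.

Definition caccept l w := 1 <= code_nth fins (crun n D q0 dels l w).

(** Transcribes [absorbs] for members with short words, each word being given by its length and its
    code; the successor in [L] is due to the strict bound in [bex]. *)
Definition absorbs_test (x : nat -> nat) :=
  let L := (length_bound U n c K s).+1 in
  bex L (fun l => bex ((D ^ n) ^ l) (fun w =>
    caccept l w && ball n (fun j => cval U n D l w j == x j)))
  || bex L (fun l => bex ((D ^ n) ^ l) (fun p =>
    caccept l p && (ball n (fun j => cval U n D l p j <= x j) &&
    ~~ bex L (fun lr => bex ((D ^ n) ^ lr) (fun r => caccept lr r &&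
       bex L (fun lt => bex ((D ^ n) ^ lt) (fun t => caccept lt t &&
         ball n (fun j =>
           cval U n D lt t j + cval U n D l p j == cval U n D lr r j + x j)))))))).

(** Here q runs over words on the fixed digits up to c, whereas p, r and t run over words of the
    given automaton. *)
Definition decide :=
  ball ((c.+1 ^ n) ^ escape_states n K s) (fun q =>
    absorbs_test (fun j => cval U n c.+1 (escape_states n K s) q j)).
End Formula.

Lemma computable_decide :
  dec 5 (fun e => decide (e 0) (e 1) (e 2) (e 3) (e 4)).
Proof.
rewrite /decide /absorbs_test /caccept.
by repeat first [apply: computable_cval | apply: computable_crun
  | apply: computable_escape_states | apply: computable_length_bound | comp_step].
Qed.


Lemma lval_cvalE (w : seq {ffun 'I_n -> 'I_c.+1}) :
  exists2 q, q < (c.+1 ^ n) ^ size w &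
    forall j, lval U w j = cval U n c.+1 (size w) q j.
Proof.
pose u := [seq [tuple (a : {ffun 'I_n -> 'I_c.+1}) j | j < n] | a <- rev w].
have [q qu cu] := codes_exist u; rewrite size_map size_rev in qu cu.
exists q => // j; rewrite -(codes_cval U j cu) -map_rev /u -map_rev revK -map_comp.
by congr nval; apply: eq_map => a; rewrite /= tnth_mktuple.
Qed.

Lemma cval_lvalE l q : q < (c.+1 ^ n) ^ l ->
  exists2 w : seq {ffun 'I_n -> 'I_c.+1}, size w = l &
    forall j, lval U w j = cval U n c.+1 l q j.
Proof.
move=> /codes_decode[u su cu].
exists (rev [seq [ffun j => tnth t j] | t <- u]); first by rewrite size_rev size_map.
move=> j; rewrite -(codes_cval U j cu) /lval map_rev -map_comp.
by congr (nval _ _ (rev _)); apply: eq_map => a; rewrite /= ffunE.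
Qed.

Section Correct.
Variable A : dfa n.
Let D := digits A.
Let dels := CodeSeq.code [seq nat_of_ord (delta q a)
                     | q <- enum 'I_(states A), a <- letters n (digits A)].
Let fins := CodeSeq.code [seq nat_of_bool (final q) | q <- enum 'I_(states A)].
Let acc := caccept D (start A) fins dels.

Lemma member_leP L x : member_le U A L x <-> exists l w,
  [/\ l < L.+1, w < (D ^ n) ^ l, acc l w & forall j : 'I_n, cval U n D l w j = x j].
Proof.
split.
  move=> [u au [ul ux]]; have [w wu cu] := codes_exist u.
  exists (size u), w; split=> //; first by rewrite /acc /caccept (codes_accepts cu).
  by move=> j; rewrite -ux -(codes_cval U j cu).
move=> [l [w [lL wl alw vx]]]; have [u su cu] := codes_decode wl.
exists u; first by move: alw; rewrite /acc /caccept (codes_accepts cu).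
by split=> [|j]; [rewrite su | rewrite -vx -(codes_cval U j cu)].
Qed.

Lemma absorbs_testP (x : nat -> nat) :
  absorbs_test D (states A) (start A) fins dels x <->
  absorbs (member_le U A (length_bound U n c K (states A))) (fun j => x j).
Proof.
set L := length_bound _ _ _ _ _; split.
  case/orP => /bexP[l lL /bexP[w wl /andP[aw]]].
    by move=> /forallP h; left; apply/member_leP; exists l, w; split=> // j; apply/eqP/h.
  move=> /andP[/forallP h nb]; right; exists (fun j => cval U n D l w j); split=> //.
    by apply/member_leP; exists l, w.
  move=> [r [t [/member_leP[lr [wr [lrL wrl ar vr]]] /member_leP[lt [wt [ltL wtl at_ vt]]]
    e]]].
  move/negP: nb; apply; apply/bexP; exists lr => //; apply/bexP; exists wr => //.
  apply/andP; split=> //; apply/bexP; exists lt => //; apply/bexP; exists wt => //.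
  by apply/andP; split=> //; apply/forallP => j; rewrite vr vt e.
case=> [/member_leP[l [w [lL wl aw vx]]]|[p [/member_leP[l [w [lL wl aw vp]]] pq nb]]].
  apply/orP; left; apply/bexP; exists l => //; apply/bexP; exists w => //.
  by apply/andP; split=> //; apply/forallP => j; rewrite vx.
apply/orP; right; apply/bexP; exists l => //; apply/bexP; exists w => //.
apply/andP; split=> //; apply/andP; split; first by apply/forallP => j; rewrite vp.
apply/negP => /bexP[lr lrL /bexP[r rl /andP[ar /bexP[lt ltL /bexP[t tl /andP[at_ /forallP
  e]]]]]].
apply: nb; exists (fun j => cval U n D lr r j), (fun j => cval U n D lt t j); split.
- by apply/member_leP; exists lr, r.
- by apply/member_leP; exists lt, t.
by move=> j; have /eqP := e j; rewrite vp.
Qed.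

Lemma decideP : decide D (states A) (start A) fins dels <->
  forall w : seq {ffun 'I_n -> 'I_c.+1}, size w = escape_states n K (states A) ->
    absorbs (member_le U A (length_bound U n c K (states A))) (lval U w).
Proof.
split.
  move=> /ballP h w sw; have [q ql vq] := lval_cvalE w.
  have -> : lval U w = fun j => cval U n c.+1 (size w) q j by apply: funext.
  by rewrite sw in ql *; apply/absorbs_testP/h.
move=> h; apply/ballP => q ql; apply/absorbs_testP.
have [w sw vw] := cval_lvalE ql.
have <- : lval U w = fun j => cval U n c.+1 (escape_states n K (states A)) q j by apply:
  funext.
exact: h.
Qed.
End Correct.

End Decision.

Theorem theorem5p9 (U : nat -> nat) (hU : pisot_system U) (n : nat) (hn : 0 < n) :
  exists f : recfun,
    forall (A : dfa n) (P : set (position n)),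
      recognizes U A P ->
      exists b : bool,
        eval f (dfa_code A) (nat_of_bool b) /\ (b = true <-> one_invariant P).
Proof.
have [c hc] := pisot_ratio hU.
have [K hK] := recog_nval_eq c.*2 hU.
have [f hf] := computable_decide n c K hU.
(* The boolean is fixed by the evaluation: it is [decide] on the five entries of [dfa_code A]. *)
exists f => A P AP; eexists; split; first exact: (hf (dfa_code A) (erefl _)).
rewrite one_invariantP (absorbing_bounded hU hn hc AP hK).
exact: decideP.
Qed.
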